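(* Let $a:\mathbb{R}\to\mathbb{R}^+$ and $f:\mathbb{R}\to\mathbb{R}$ be of class $C^2(\mathbb{R})$, with $a\ge\nu$ on $\mathbb{R}$ for some $\nu>0$. Let $B_1(0)$ be the unit ball of $\mathbb{R}^N$, $N\ge1$, and consider the problem $$(P)\qquad \mathrm{div}(a(u)Du)=\frac{a'(u)}{2}|Du|^2+f(u)\ \text{ in }B_1(0),\qquad u(x)\to+\infty\ \text{ as } d(x,\partial B_1(0))\to0 .$$ For constants $k,\beta,\gamma,a_\infty,f_\infty>0$ and $p>1$ consider the conditions \begin{align*} (A_{pol})\quad&\lim_{s\to+\infty}\frac{a'(s)}{s^{k-1}}=ka_\infty,\qquad \lim_{s\to+\infty}\frac{a''(s)}{s^{k-2}}=k(k-1)a_\infty\quad(\text{only the second limit is required when } k>1);\\ (A_{exp})\quad&\lim_{s\to+\infty}\frac{a''(s)}{e^{2\gamma s}}=4\gamma^2a_\infty;\\ (A_{log})\quad&\lim_{s\to+\infty}\frac{a'(s)\,s}{(\log s)^{2\gamma-1}}=2\gamma a_\infty,\qquad \lim_{s\to+\infty}\frac{a''(s)\,s^2}{(\log s)^{2\gamma-1}}=-2\gamma a_\infty;\\ (F_{exp})\quad&\lim_{s\to+\infty}\frac{f''(s)}{e^{2\beta s}}=4\beta^2f_\infty;\\ (F_{pol})\quad&\lim_{s\to+\infty}\frac{f''(s)}{s^{p-2}}=p(p-1)f_\infty . \end{align*} The following facts hold. (1) If there exist $k>0,\beta>0,a_\infty>0,f_\infty>0$ such that $(A_{pol})$ and $(F_{exp})$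 hold, then any solution to $(P)$ is radially symmetric and increasing. (2) If there exist $k>0,p>1,a_\infty>0,f_\infty>0$ such that $(A_{pol})$ and $(F_{pol})$ hold, and $p>k+1$, then any solution to $(P)$ is radially symmetric and increasing. (3) If there exist $\gamma>0,\beta>0,a_\infty>0,f_\infty>0$ such that $(A_{exp})$ and $(F_{exp})$ hold, and $\beta>\gamma$, then any solution to $(P)$ is radially symmetric and increasing. (4) If there exist $\gamma>0,\beta>0,a_\infty>0,f_\infty>0$ such that $(A_{log})$ and $(F_{exp})$ hold, then any solution to $(P)$ is radially symmetric and increasing. (5) If $(A_{log})$ and $(F_{pol})$ hold (for some $\gamma>0,a_\infty>0,f_\infty>0$ and $p$), and $p>1$, then any solution to $(P)$ is radially symmetric and increasing.
   Context: $d(x,\partial B_1(0))$ is the distance of $x$ from the unit sphere. A solution is a classical solution $u\in C^2(B_1(0))$. ''Radially symmetric and increasing'' means that $u$ is a function of $|x|$ which is increasing in $|x|$. *)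

(* Defs.v *)
From HB Require Import structures.
From mathcomp Require Import all_boot all_order all_algebra.
From mathcomp Require Import all_classical all_reals all_analysis.
Set Implicit Arguments.
Unset Strict Implicit.
Unset Printing Implicit Defensive.
Import Order.TTheory GRing.Theory Num.Theory.
Import numFieldNormedType.Exports.
Local Open Scope ring_scope.
Local Open Scope classical_set_scope.

Section Euclidean.
Variables (R : realType) (N : nat).
Implicit Types (x : 'rV[R]_N) (A : set 'rV[R]_N) (g : 'rV[R]_N -> R).

(* The library norm `|x| on 'rV[R]_N is the sup norm, which induces the same
   topology but not the same ball. *)
Definition enorm x : R := Num.sqrt (\sum_(i < N) x 0 i ^+ 2).

Definition unit_ball : set 'rV[R]_N := [set x | enorm x < 1].
Definition unit_sphere : set 'rV[R]_N := [set x | enorm x = 1].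

Definition dist_to A x : R := inf [set enorm (x - y) | y in A].

Definition partial (i : 'I_N) g x : R := 'D_(delta_mx 0 i) g x.

Definition grad g x : 'rV[R]_N := \row_i partial i g x.

Definition divergence (F : 'rV[R]_N -> 'rV[R]_N) x : R :=
  \sum_(i < N) partial i (fun y => F y 0 i) x.

(* Meant for open A: the derivatives at a point of A then only depend on the
   restriction of g to A. *)
Fixpoint class_C (k : nat) A g : Prop :=
  (forall x, A x -> {for x, continuous g}) /\
  if k is k'.+1 then
    forall i : 'I_N,
      (forall x, A x -> derivable g x (delta_mx 0 i)) /\
      class_C k' A (partial i g)
  else True.

Definition blows_up_at_sphere g : Prop :=
  forall M : R, exists2 delta : R, 0 < delta &
    forall x, unit_ball x -> dist_to unit_sphere x < delta -> M < g x.

Definition solves_P (a f : R -> R) (u : 'rV[R]_N -> R) : Prop :=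
  [/\ class_C 2 unit_ball u,
      forall x, unit_ball x ->
        divergence (fun y => a (u y) *: grad u y) x =
          derive1 a (u x) / 2 * enorm (grad u x) ^+ 2 + f (u x) &
      blows_up_at_sphere u].

Definition radial_increasing (u : 'rV[R]_N -> R) : Prop :=
  exists2 g : R -> R,
    (forall x, unit_ball x -> u x = g (enorm x)) &
    (forall r s, 0 <= r -> r < s -> s < 1 -> g r < g s).

End Euclidean.

Section Growth.
Variable R : realType.
Implicit Types a f g : R -> R.

Definition class_C2 g : Prop :=
  [/\ forall s, derivable g s 1,
      forall s, derivable (derive1 g) s 1 &
      continuous (derive1n 2 g)].

Definition A_pol a (k ainf : R) : Prop :=
  (k <= 1 -> derive1 a s / s `^ (k - 1) @[s --> +oo] --> k * ainf) /\
  derive1n 2 a s / s `^ (k - 2) @[s --> +oo] --> k * (k - 1) * ainf.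

Definition A_exp a (gamma ainf : R) : Prop :=
  derive1n 2 a s / expR (2 * gamma * s) @[s --> +oo] --> 4 * gamma ^+ 2 * ainf.

Definition A_log a (gamma ainf : R) : Prop :=
  derive1 a s * s / ln s `^ (2 * gamma - 1) @[s --> +oo] --> 2 * gamma * ainf /\
  derive1n 2 a s * s ^+ 2 / ln s `^ (2 * gamma - 1) @[s --> +oo]
    --> - (2 * gamma * ainf).

Definition F_exp f (beta finf : R) : Prop :=
  derive1n 2 f s / expR (2 * beta * s) @[s --> +oo] --> 4 * beta ^+ 2 * finf.

Definition F_pol f (p finf : R) : Prop :=
  derive1n 2 f s / s `^ (p - 2) @[s --> +oo] --> p * (p - 1) * finf.

End Growth.

(* Main.v *)
(* Let G' = sqrt a and v = G(u). Then v solves Lap v = h(v), where h(G s) =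
   f(s)/sqrt(a(s)), and the growth conditions make h(s)/s^(1+delta) nondecreasing
   for large s.

   This superlinearity makes c v(x/t), with c = t^(-2/delta) and t < 1, a
   supersolution that is infinite on the sphere of radius t. Comparing it, after
   composition with an orthogonal map and up to a multiple of 1 - |x|^2, with v and
   letting t -> 1 shows that v(y) <= v(x) + K (1 - |x|^2) whenever |y| <= |x| and
   |x| is close to 1. Hence the difference between v and its reflection in a
   hyperplane has nonnegative inferior limit on the boundary of the cap cut off by
   the hyperplane, corner included, and the method of moving planes applies:
   near the sphere h is monotone, near the hyperplane the cap is narrow, and in
   between the strong maximum principle and compactness give positivity. *)

Require Import Defs.
From HB Require Import structures.
From mathcomp Require Import all_boot all_order all_algebra.
From mathcomp Require Import all_classical all_reals all_analysis.
From mathcomp Require Import ring lra.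
Set Implicit Arguments.
Unset Strict Implicit.
Unset Printing Implicit Defensive.
Import Order.TTheory GRing.Theory Num.Theory.
Import numFieldNormedType.Exports.
Local Open Scope ring_scope.
Local Open Scope classical_set_scope.

(** * Euclidean geometry and second-order expansions *)

Section Euclid.
Variables (R : realType) (N : nat).
Implicit Types (x y h e : 'rV[R]_N) (L H : 'M[R]_N).

(** The gradient term makes the equation the Euler-Lagrange equation of the energy density
    a(u)|Du|^2/2 + F(u) with F' = f; this is why the substitution leaves no first-order term. The
    obstacle is the corner where the hyperplane meets the sphere: a point and its mirror image both
    approach the sphere there, and the difference of the two values of v has the form infinity minus
    infinity. No boundary rate of v or of its gradient is computed. An additive error that vanishes
    on the sphere takes its place, and it does two further jobs: its Laplacian -2NK makes the
    dilated function a strict supersolution, and its size in a fixed smaller ball covers the region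
    where v may be small and h is not under control. Pointwise second-order expansions are used
    instead of derivatives because every comparison ends at a contact point, where only the trace of
    the quadratic part matters, and because they compose well with affine maps and with functions of
    one variable. *)

Definition dot x y : R := \sum_(i < N) x 0 i * y 0 i.

Lemma dotC x y : dot x y = dot y x.
Proof. by apply: eq_bigr => i _; rewrite mulrC. Qed.

Lemma dotDl x y h : dot (x + y) h = dot x h + dot y h.
Proof. by rewrite -big_split; apply: eq_bigr => i _; rewrite mxE mulrDl. Qed.

Lemma dotZl c x y : dot (c *: x) y = c * dot x y.
Proof. by rewrite mulr_sumr; apply: eq_bigr => i _; rewrite mxE mulrA. Qed.

Lemma dotNl x y : dot (- x) y = - dot x y.
Proof. by rewrite -scaleN1r dotZl mulN1r. Qed.

Lemma dotDr h x y : dot h (x + y) = dot h x + dot h y.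
Proof. by rewrite dotC dotDl !(dotC h). Qed.

Lemma dotZr c x y : dot x (c *: y) = c * dot x y.
Proof. by rewrite dotC dotZl dotC. Qed.

Lemma dotNr x y : dot x (- y) = - dot x y.
Proof. by rewrite dotC dotNl dotC. Qed.

Lemma dot0l x : dot 0 x = 0.
Proof. by rewrite -(scale0r (0 : 'rV[R]_N)) dotZl mul0r. Qed.

Definition dotE := (dotDl, dotDr, dotNl, dotNr, dotZl, dotZr).

Lemma dot_ge0 x : 0 <= dot x x.
Proof. by apply: sumr_ge0 => i _; rewrite -expr2 sqr_ge0. Qed.

Lemma dot_mulmx x L y : dot (x *m L) y = dot x (y *m L^T).
Proof.
rewrite /dot; under eq_bigr do rewrite mxE mulr_suml.
rewrite exchange_big; apply: eq_bigr => i _ /=.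
by rewrite mxE mulr_sumr; apply: eq_bigr => j _; rewrite mxE; ring.
Qed.

Lemma enorm_sqr x : enorm x ^+ 2 = dot x x.
Proof.
rewrite /enorm sqr_sqrtr; first by apply: eq_bigr => i _; rewrite expr2.
by apply: sumr_ge0 => i _; rewrite sqr_ge0.
Qed.

Lemma enorm_ge0 x : 0 <= enorm x.
Proof. exact: sqrtr_ge0. Qed.

Lemma enormE x : enorm x = Num.sqrt (dot x x).
Proof. by rewrite -enorm_sqr sqrtr_sqr ger0_norm // enorm_ge0. Qed.

Lemma enorm0 : enorm (0 : 'rV[R]_N) = 0.
Proof. by rewrite enormE dot0l sqrtr0. Qed.

Lemma coord_le_enorm x i : `|x 0 i| <= enorm x.
Proof.
rewrite -sqrtr_sqr ler_wsqrtr // (bigD1 i) //= lerDl.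
by apply: sumr_ge0 => j _; rewrite sqr_ge0.
Qed.

Lemma enorm_eq0 x : enorm x = 0 -> x = 0.
Proof.
move=> x0; apply/rowP => i; rewrite mxE; apply/normr0_eq0/eqP.
by rewrite eq_le normr_ge0 andbT -x0 coord_le_enorm.
Qed.

Lemma enormZ c x : enorm (c *: x) = `|c| * enorm x.
Proof. by rewrite !enormE dotZl dotZr mulrA -expr2 sqrtrM ?sqr_ge0 // sqrtr_sqr. Qed.

Lemma enormN x : enorm (- x) = enorm x.
Proof. by rewrite -scaleN1r enormZ normrN1 mul1r. Qed.

Lemma cauchy_schwarz x y : `|dot x y| <= enorm x * enorm y.
Proof.
have [y0|ny0] := eqVneq (enorm y) 0.
  by rewrite y0 (enorm_eq0 y0) dotC dot0l normr0 mulr0.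
have yy : 0 < dot y y by rewrite -enorm_sqr exprn_gt0 // lt_def ny0 enorm_ge0.
rewrite -ler_sqr ?nnegrE ?normr_ge0 ?mulr_ge0 ?enorm_ge0 //.
rewrite exprMn !enorm_sqr real_normK ?num_real //.
have := dot_ge0 (dot y y *: x - dot x y *: y).
rewrite !dotE (dotC y x) => H.
suff : 0 <= dot y y * (dot x x * dot y y - dot x y ^+ 2).
  by rewrite pmulr_rge0 // subr_ge0.
apply: le_trans H _; rewrite le_eqVlt; apply/orP; left; apply/eqP; ring.
Qed.

Lemma dot_le x y : dot x y <= enorm x * enorm y.
Proof. exact: le_trans (ler_norm _) (cauchy_schwarz x y). Qed.

Lemma enormD x y : enorm (x + y) <= enorm x + enorm y.
Proof.
rewrite -ler_sqr ?nnegrE ?addr_ge0 ?enorm_ge0 // sqrrD !enorm_sqr !dotE (dotC y x).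
by have := dot_le x y; lra.
Qed.

Lemma enormB x y : enorm x - enorm y <= enorm (x - y).
Proof. by rewrite lerBlDr -{1}(subrK y x); exact: enormD. Qed.

Lemma enorm_le_sum x : enorm x <= \sum_i `|x 0 i|.
Proof.
have S0 : 0 <= \sum_i `|x 0 i| by apply: sumr_ge0 => i _; exact: normr_ge0.
rewrite -ler_sqr ?nnegrE ?enorm_ge0 // enorm_sqr expr2 mulr_suml.
apply: ler_sum => i _; apply: le_trans (ler_norm _) _; rewrite normrM ler_wpM2l //.
by rewrite (bigD1 i) //= lerDl; apply: sumr_ge0.
Qed.

Lemma norm_le_enorm x : `|x| <= enorm x.
Proof.
rewrite {1}/Num.norm /= mx_normrE; apply: bigmax_le => [|[i j] _]; first exact: enorm_ge0.
by rewrite ord1 coord_le_enorm.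
Qed.

Lemma coord_le_norm x i : `|x 0 i| <= `|x|.
Proof.
rewrite [leRHS]/Num.norm /= mx_normrE.
exact: (@le_bigmax _ R _ 0 (fun k : 'I_1 * 'I_N => `|x k.1 k.2|) (0, i)).
Qed.

Lemma enorm_le_norm x : enorm x <= N%:R * `|x|.
Proof.
apply: le_trans (enorm_le_sum x) _.
apply: (@le_trans _ _ (\sum_(i < N) `|x|)); last first.
  by rewrite sumr_const card_ord mulr_natl.
by apply: ler_sum => i _; exact: coord_le_norm.
Qed.

Lemma mulmx_bound L : exists2 B, 0 <= B & forall h, enorm (h *m L) <= B * enorm h.
Proof.
exists (\sum_j \sum_i `|L i j|).
  by apply: sumr_ge0 => j _; apply: sumr_ge0.
move=> h; apply: le_trans (enorm_le_sum _) _; rewrite mulr_suml.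
apply: ler_sum => j _; rewrite mxE; apply: le_trans (ler_norm_sum _ _ _) _.
rewrite mulr_suml; apply: ler_sum => i _; rewrite normrM mulrC ler_wpM2l //.
exact: coord_le_enorm.
Qed.

(** The bridge from epsilon-delta statements in the Euclidean norm to the library neighbourhoods,
    which come from the sup norm. *)
Lemma near_enorm x (P : set 'rV[R]_N) :
  (exists2 d, 0 < d & forall h, enorm h < d -> P (x + h)) <-> \forall y \near x, P y.
Proof.
split=> [[d d0 Pd]|].
  have N0 : 0 < N%:R + 1 :> R by rewrite ltr_wpDl.
  apply/nbhs_normP; exists (d / (N%:R + 1)); first by rewrite /= divr_gt0.
  move=> y /=; rewrite distrC ltr_pdivlMr // => yd.
  rewrite -(subrK x y) addrC; apply: Pd; apply: le_lt_trans (enorm_le_norm _) _.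
  apply: le_lt_trans yd; rewrite mulrC ler_wpM2l //; lra.
move=> /nbhs_normP[d /= d0 Pd]; exists d => // h hd; apply: Pd.
by rewrite /= opprD addNKr normrN (le_lt_trans (norm_le_enorm _)).
Qed.

Lemma continuous_atP (g : 'rV[R]_N -> R) x : {for x, continuous g} <->
  forall e : R, 0 < e -> exists2 d, 0 < d & forall h, enorm h < d -> `|g (x + h) - g x| < e.
Proof.
split=> [gx e e0|gx].
  by apply/(near_enorm x (fun y => `|g y - g x| < e)); move/cvgrPdistC_lt: gx; apply.
apply/(@cvgrPdistC_lt _ _ _ _ (nbhs_filter x)) => e e0.
by apply/(near_enorm x (fun y => `|g y - g x| < e)); exact: gx.
Qed.

Lemma continuous_enorm : continuous (@enorm R N).
Proof.
move=> x; apply/continuous_atP => e e0; exists e => // h he.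
rewrite ltr_norml; apply/andP; split.
  have := enormB x (- h); rewrite opprK enormN; have := enorm_ge0 h; lra.
have := enormD x h; have := enorm_ge0 h; lra.
Qed.

Lemma continuous_dot e : continuous (dot e).
Proof.
move=> x; apply/continuous_atP => r r0; exists (r / (enorm e + 1)).
  by rewrite divr_gt0 // ltr_wpDl // enorm_ge0.
move=> h; rewrite ltr_pdivlMr ?ltr_wpDl ?enorm_ge0 // => hr.
rewrite dotDr addrAC subrr add0r; apply: le_lt_trans (cauchy_schwarz _ _) _.
apply: le_lt_trans hr; rewrite mulrC ler_wpM2l ?enorm_ge0 //; lra.
Qed.

Lemma compact_ball (r : R) : compact [set x : 'rV[R]_N | enorm x <= r].
Proof.
apply: bounded_closed_compact.
  exists r; split; first exact: num_real.
  move=> M rM x /= xr; apply: le_trans (norm_le_enorm x) _; lra.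
have -> : [set x : 'rV[R]_N | enorm x <= r] = @enorm R N @^-1` [set y | y <= r] by [].
apply: closed_comp; last exact: closed_le.
by move=> x _; exact: continuous_enorm.
Qed.

Lemma compact_cap (r l : R) e :
  compact [set x : 'rV[R]_N | enorm x <= r /\ l <= dot e x].
Proof.
apply: (@subclosed_compact _ _ [set x : 'rV[R]_N | enorm x <= r]);
  [|exact: compact_ball|by move=> x []].
apply: closedI.
  apply: (@closed_comp _ _ (@enorm R N) [set y | y <= r]); last exact: closed_le.
  by move=> x _; exact: continuous_enorm.
apply: (@closed_comp _ _ (dot e) [set y | l <= y]); last exact: closed_ge.
by move=> x _; exact: continuous_dot.
Qed.

End Euclid.

(** * Second-order expansions at a point *)

Section Jets.
Variables (R : realType) (N : nat).
Implicit Types (x y h e p : 'rV[R]_N) (L H : 'M[R]_N) (g : 'rV[R]_N -> R).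

(* Second-order Taylor expansion with Peano remainder; H need not be symmetric,
   only its quadratic form and its trace (the Laplacian) matter. *)
Definition jet2 g x p H := forall e : R, 0 < e -> exists2 d, 0 < d &
  forall h, enorm h < d ->
    `|g (x + h) - g x - dot p h - dot (h *m H) h / 2| <= e * enorm h ^+ 2.

Lemma jet2_cst (c : R) x : jet2 (fun=> c) x 0 0.
Proof.
move=> e e0; exists 1 => // h _.
by rewrite mulmx0 !dot0l mul0r !subr0 subrr normr0 mulr_ge0 ?sqr_ge0 // ltW.
Qed.

Lemma jet2_dot e x : jet2 (dot e) x e 0.
Proof.
move=> r r0; exists 1 => // h _.
have -> : dot e (x + h) - dot e x - dot e h = 0 by rewrite dotDr; ring.
by rewrite mulmx0 dot0l mul0r subr0 normr0 mulr_ge0 ?sqr_ge0 // ltW.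
Qed.

Lemma jet2_sqdist y x : jet2 (fun z => dot (z - y) (z - y)) x (2 *: (x - y)) 2%:M.
Proof.
move=> r r0; exists 1 => // h _.
rewrite [X in `|X|](_ : _ = 0); first by rewrite normr0 mulr_ge0 ?sqr_ge0 // ltW.
rewrite mul_mx_scalar !dotE (dotC y x) (dotC y h) (dotC x h); lra.
Qed.

Lemma jet2D g1 g2 x p1 p2 H1 H2 : jet2 g1 x p1 H1 -> jet2 g2 x p2 H2 ->
  jet2 (fun y => g1 y + g2 y) x (p1 + p2) (H1 + H2).
Proof.
move=> J1 J2 e e0; have e2 : 0 < e / 2 by rewrite divr_gt0.
have [d1 d10 D1] := J1 _ e2; have [d2 d20 D2] := J2 _ e2.
exists (Num.min d1 d2); first by rewrite lt_min d10.
move=> h; rewrite lt_min => /andP[/D1 A1 /D2 A2].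
rewrite mulmxDr !dotDl.
have := lerD A1 A2; rewrite -mulrDl -splitr; apply: le_trans.
apply: le_trans (ler_normD _ _); rewrite le_eqVlt; apply/orP; left; apply/eqP.
congr `|_|; lra.
Qed.

Lemma jet2Z c g x p H : jet2 g x p H -> jet2 (fun y => c * g y) x (c *: p) (c *: H).
Proof.
move=> J e e0; have c0 : 0 < `|c| + 1 by rewrite ltr_wpDl.
have [d d0 D] := J _ (divr_gt0 e0 c0); exists d => // h /D A.
rewrite -scalemxAr !dotZl [X in `|X|](_ : _ = c * (g (x + h) - g x - dot p h - dot (h *m H) h / 2)).
  rewrite normrM; apply: (@le_trans _ _ ((`|c| + 1) * (e / (`|c| + 1) * enorm h ^+ 2))).
    by apply: ler_pM => //; rewrite lerDl.
  by rewrite mulrA (mulrC (`|c| + 1)) divfK // gt_eqF.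
lra.
Qed.

Lemma jet2B g1 g2 x p1 p2 H1 H2 : jet2 g1 x p1 H1 -> jet2 g2 x p2 H2 ->
  jet2 (fun y => g1 y - g2 y) x (p1 - p2) (H1 - H2).
Proof.
move=> J1 /(@jet2Z (-1)) J2; have := jet2D J1 J2; rewrite !scaleN1r.
by under [X in jet2 X]funext do rewrite mulN1r.
Qed.

Lemma jet2_affine g x b L p H : jet2 g (x *m L + b) p H ->
  jet2 (fun y => g (y *m L + b)) x (p *m L^T) (L *m H *m L^T).
Proof.
move=> J e e0; have [B B0 LB] := mulmx_bound L.
have B1 : 0 < B + 1 by rewrite ltr_wpDl.
have [d d0 D] := J _ (divr_gt0 e0 (exprn_gt0 2 B1)).
exists (d / (B + 1)); first exact: divr_gt0.
move=> h; rewrite ltr_pdivlMr // => hd.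
have hB : enorm (h *m L) <= (B + 1) * enorm h.
  by apply: le_trans (LB h) _; rewrite ler_wpM2r ?enorm_ge0 ?lerDl.
have /D : enorm (h *m L) < d by apply: le_lt_trans hB _; rewrite mulrC.
move=> A; have -> : (x + h) *m L + b = x *m L + b + h *m L by rewrite mulmxDl addrAC.
rewrite !mulmxA !(dot_mulmx _ L^T) trmxK; apply: le_trans A _.
apply: (@le_trans _ _ (e / (B + 1) ^+ 2 * ((B + 1) * enorm h) ^+ 2)).
  apply: ler_wpM2l; first by rewrite divr_ge0 ?sqr_ge0 // ltW.
  by rewrite ler_sqr // nnegrE ?mulr_ge0 ?enorm_ge0 // ltW.
rewrite exprMn mulrA divfK // expf_neq0 // gt_eqF //.
Qed.

Lemma jet2_lip g x p H : jet2 g x p H -> exists2 d, 0 < d & exists2 C, 0 <= C &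
  forall h, enorm h < d -> `|g (x + h) - g x - dot p h| <= C * enorm h ^+ 2.
Proof.
move=> J; have [d d0 D] := J 1 ltr01; have [B B0 HB] := mulmx_bound H.
exists d => //; exists (1 + B); first lra.
move=> h /D A; rewrite -(subrK (dot (h *m H) h / 2) (_ - _)).
apply: le_trans (ler_normD _ _) _; rewrite mulrDl; apply: lerD => //.
have := le_trans (cauchy_schwarz (h *m H) h) (ler_wpM2r (enorm_ge0 h) (HB h)).
rewrite normrM (@ger0_norm _ 2^-1) ?invr_ge0 // -mulrA -expr2.
have := normr_ge0 (dot (h *m H) h); lra.
Qed.

Lemma jet2_continuous g x p H : jet2 g x p H -> {for x, continuous g}.
Proof.
move=> /jet2_lip[d d0 [C C0 D]]; apply/continuous_atP => e e0.
pose K := C + enorm p + 1; have K0 : 0 < K.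
  by rewrite /K; have := enorm_ge0 p; lra.
exists (Num.min (Num.min d 1) (e / K)); first by rewrite !lt_min d0 ltr01 divr_gt0.
move=> h; rewrite !lt_min ltr_pdivlMr // => /andP[/andP[/D A h1] hK].
apply: le_lt_trans hK; rewrite -(subrK (dot p h) (_ - _)).
apply: le_trans (ler_normD _ _) _.
have := cauchy_schwarz p h; have := enorm_ge0 h; rewrite /K => h0 Cs.
have : C * enorm h ^+ 2 <= C * enorm h by apply: ler_wpM2l => //; nra.
nra.
Qed.

Lemma jet2_comp (F : R -> R) (F1 F2 : R) g x p H : jet2 g x p H ->
  (forall e : R, 0 < e -> exists2 d, 0 < d & forall k, `|k| < d ->
    `|F (g x + k) - F (g x) - F1 * k - F2 * k ^+ 2 / 2| <= e * k ^+ 2) ->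
  jet2 (fun y => F (g y)) x (F1 *: p) (F1 *: H + F2 *: (p^T *m p)).
Proof.
move=> J TF e e0; have [d1 d10 [C C0 D1]] := jet2_lip J.
pose K := C + enorm p + 1; have K0 : 0 < K.
  by rewrite /K; have := enorm_ge0 p; lra.
have e1 : 0 < e / 3 / K ^+ 2 by rewrite !divr_gt0 // exprn_gt0.
have [d2 d20 D2] := TF _ e1.
have F10 : 0 < `|F1| + 1 by rewrite ltr_wpDl.
have F20 : 0 < (`|F2| + 1) * K * K by rewrite !mulr_gt0 // ltr_wpDl.
have e2 : 0 < e / 3 / (`|F1| + 1) by rewrite !divr_gt0.
have [d3 d30 D3] := J _ e2.
have e3 : 0 < e / 3 / ((`|F2| + 1) * K * K) by rewrite !divr_gt0.
pose d := Num.min (Num.min d1 d3) (Num.min 1 (Num.min (d2 / K) (e / 3 / ((`|F2| + 1) * K * K)))).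
exists d; first by rewrite /d !lt_min d10 d30 ltr01 divr_gt0 // e3.
move=> h; rewrite /d !lt_min => /andP[/andP[/D1 A1 /D3 A3]] /andP[h1] /andP[hd2 he3].
rewrite ltr_pdivlMr // in hd2; rewrite ltr_pdivlMr // in he3.
set k := g (x + h) - g x in A1 A3; set n := enorm h in A1 A3 h1 hd2 he3 *.
have n0 : 0 <= n := enorm_ge0 h.
have Cs : `|dot p h| <= enorm p * n := cauchy_schwarz p h.
have n2 : n ^+ 2 <= n by nra.
have kK : `|k| <= K * n.
  rewrite -(subrK (dot p h) k); apply: le_trans (ler_normD _ _) _.
  have : C * n ^+ 2 <= C * n by rewrite ler_wpM2l.
  rewrite /K; nra.
have k2 : k ^+ 2 <= K ^+ 2 * n ^+ 2.
  by rewrite -(@real_normK _ k) ?num_real // -exprMn ler_sqr // nnegrE mulr_ge0 // ltW.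
have /D2 : `|k| < d2 by apply: le_lt_trans kK _; rewrite mulrC.
rewrite /k (addrC (g x)) subrK -/k => A2.
(* Three errors of size e/3: the Taylor remainder of [F], [F1] times the remainder of [g], and the
   replacement of k^2 by (p.h)^2. *)
have B2 : `|F (g (x + h)) - F (g x) - F1 * k - F2 * k ^+ 2 / 2| <= e / 3 * n ^+ 2.
  apply: le_trans A2 _; rewrite -(mulrA (e / 3)).
  apply: ler_wpM2l; first by rewrite divr_ge0 // ltW.
  rewrite mulrC; by rewrite ler_pdivrMr ?exprn_gt0 // mulrC.
have B3 : `|F1 * (k - dot p h - dot (h *m H) h / 2)| <= e / 3 * n ^+ 2.
  rewrite normrM; apply: (@le_trans _ _ ((`|F1| + 1) * (e / 3 / (`|F1| + 1) * n ^+ 2))).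
    by apply: ler_pM => //; rewrite lerDl.
  by rewrite mulrA (mulrC (`|F1| + 1)) divfK // gt_eqF.
have B4 : `|F2 * (k ^+ 2 - dot p h ^+ 2) / 2| <= e / 3 * n ^+ 2.
  have E1 : `|k + dot p h| <= 2 * (K * n).
    apply: le_trans (ler_normD _ _) _; have : enorm p * n <= K * n by rewrite ler_wpM2r // /K; lra.
    lra.
  have E2 : `|k - dot p h| <= K * n ^+ 2.
    apply: le_trans A1 _; rewrite ler_wpM2r ?sqr_ge0 // /K; have := enorm_ge0 p; lra.
  have E3 : `|k ^+ 2 - dot p h ^+ 2| <= 2 * (K * n ^+ 2) * (K * n).
    rewrite subr_sqr normrM; apply: le_trans (ler_pM _ _ E2 E1) _ => //; nra.
  rewrite !normrM (@ger0_norm _ 2^-1) ?invr_ge0 //.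
  have F2p : `|F2| <= `|F2| + 1 by rewrite lerDl.
  have E4 := ler_pM (normr_ge0 _) (normr_ge0 _) F2p E3.
  have E5 : (n * ((`|F2| + 1) * K * K)) * n ^+ 2 <= (e / 3) * n ^+ 2.
    by rewrite ler_wpM2r ?sqr_ge0 // ltW.
  lra.
have pp : dot (h *m (p^T *m p)) h = dot p h ^+ 2.
  rewrite mulmxA (_ : h *m p^T = (dot p h)%:M); last first.
    apply/matrixP => i j; rewrite !ord1 !mxE mulr1n; apply: eq_bigr => l _.
    by rewrite mxE mulrC.
  by rewrite mul_scalar_mx dotZl expr2.
rewrite mulmxDr -!scalemxAr !dotDl !dotZl pp.
have -> : F (g (x + h)) - F (g x) - F1 * dot p h -
    (F1 * dot (h *m H) h + F2 * dot p h ^+ 2) / 2 =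
  (F (g (x + h)) - F (g x) - F1 * k - F2 * k ^+ 2 / 2) +
  F1 * (k - dot p h - dot (h *m H) h / 2) + F2 * (k ^+ 2 - dot p h ^+ 2) / 2 by lra.
apply: le_trans (ler_normD _ _) _; apply: le_trans (lerD (ler_normD _ _) (lexx _)) _.
lra.
Qed.

Lemma mxtrace_tr_mul p : \tr (p^T *m p) = enorm p ^+ 2.
Proof.
rewrite mxtrace_mulC /mxtrace big_ord1 !mxE enorm_sqr.
by apply: eq_bigr => i _; rewrite mxE.
Qed.

Lemma mxtrace_orth L H : L^T *m L = 1%:M -> \tr (L *m H *m L^T) = \tr H.
Proof. by move=> LL; rewrite -mulmxA mxtrace_mulC -mulmxA LL mulmx1. Qed.

(** Adding the expansions at t e_i and -t e_i cancels the gradient and leaves t^2 [H i i] up to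
    o(t^2), so no diagonal entry is negative. *)
Lemma jet2_min g x p H : jet2 g x p H ->
  (exists2 d, 0 < d & forall h, enorm h < d -> g x <= g (x + h)) -> 0 <= \tr H.
Proof.
move=> J [d d0 m]; apply: sumr_ge0 => i _; rewrite leNgt; apply/negP => Hi.
have k0 : 0 < - H i i / 4 by rewrite divr_gt0 ?oppr_gt0.
have [d1 d10 D] := J _ k0.
pose t := Num.min d d1 / 2; have t0 : 0 < t by rewrite divr_gt0 // lt_min d0.
have mt : t < Num.min d d1.
  by rewrite /t ltr_pdivrMr // ltr_pMr ?ltr1n // lt_min d0.
pose h : 'rV[R]_N := t *: delta_mx 0 i.
have ee : dot (delta_mx 0 i : 'rV[R]_N) (delta_mx 0 i) = 1.
  rewrite /dot (bigD1 i) //= big1 ?addr0 ?mxE ?eqxx ?mulr1 // => j ji.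
  by rewrite !mxE eqxx (negbTE ji) mul0r.
have eh : enorm h = t by rewrite enormZ enormE ee sqrtr1 mulr1 ger0_norm // ltW.
have hH : dot (h *m H) h = t ^+ 2 * H i i.
  rewrite /h -scalemxAl dotZl dotZr mulrA -expr2; congr (_ * _).
  rewrite -rowE /dot (bigD1 i) //= !mxE !eqxx mulr1 big1 ?addr0 // => j ji.
  by rewrite !mxE eqxx (negbTE ji) mulr0.
move: mt; rewrite lt_min => /andP[td td1].
have := m h; rewrite eh => /(_ td) m1.
have := m (- h); rewrite enormN eh => /(_ td) m2.
have := D h; rewrite eh => /(_ td1); rewrite ler_norml => /andP[_ A1].
have := D (- h); rewrite enormN eh => /(_ td1); rewrite ler_norml => /andP[_ A2].
have t2 : 0 < t ^+ 2 by rewrite exprn_gt0.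
move: A1 A2; rewrite mulNmx !(dotNl, dotNr) opprK hH; nra.
Qed.

End Jets.

(** * Reflections and the minimum principle *)

Section Reflections.
Variables (R : realType) (N : nat).
Implicit Types (x y e : 'rV[R]_N) (l : R).

Lemma mulmx_outer x e : x *m (e^T *m e) = dot x e *: e.
Proof.
rewrite mulmxA -mul_scalar_mx; congr (_ *m _); apply/matrixP => i j.
by rewrite !ord1 !mxE mulr1n; apply: eq_bigr => k _; rewrite mxE.
Qed.

Definition refl_mx e : 'M[R]_N := 1%:M - 2 *: (e^T *m e).

Lemma mulmx_refl x e : x *m refl_mx e = x - (2 * dot x e) *: e.
Proof. by rewrite mulmxBr mulmx1 -scalemxAr mulmx_outer scalerA. Qed.

Lemma refl_mxT e : (refl_mx e)^T = refl_mx e.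
Proof. by rewrite !linearB /= trmx1 linearZ /= trmx_mul trmxK. Qed.

Lemma refl_mx_orth e : dot e e = 1 -> (refl_mx e)^T *m refl_mx e = 1%:M.
Proof.
move=> ee; rewrite refl_mxT; apply/row_matrixP => i.
rewrite !rowE mulmxA mulmx1 !mulmx_refl !dotE ee mulr1.
by rewrite [dot _ e - _](_ : _ = - dot (delta_mx 0 i) e); [rewrite mulrN scaleNr opprK subrK | ring].
Qed.

Lemma orth_enorm (L : 'M[R]_N) x : L^T *m L = 1%:M -> enorm (x *m L) = enorm x.
Proof. by move=> LL; rewrite !enormE dot_mulmx -mulmxA (mulmx1C LL) mulmx1. Qed.

(** The Householder reflection in the bisecting hyperplane of x and y: equal norms give |x-y|^2 = 2
    x.(x-y), which makes it send x to y. *)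
Lemma exists_orth_map x y : enorm x = enorm y ->
  exists2 L : 'M[R]_N, L^T *m L = 1%:M & x *m L = y.
Proof.
move=> xy; have [->|nxy] := eqVneq x y.
  by exists 1%:M; rewrite ?mulmx1 ?trmx1.
have n0 : 0 < enorm (x - y).
  rewrite lt_def enorm_ge0 andbT; apply: contra nxy => /eqP/enorm_eq0/eqP.
  by rewrite subr_eq0.
have D : dot (x - y) (x - y) = 2 * dot x (x - y).
  have : dot x x = dot y y by rewrite -!enorm_sqr xy.
  by rewrite !dotE (dotC y x); lra.
pose e := (enorm (x - y))^-1 *: (x - y).
have ee : dot e e = 1.
  by rewrite dotZl dotZr -enorm_sqr; field; rewrite gt_eqF.
exists (refl_mx e); first exact: refl_mx_orth.
rewrite mulmx_refl dotZr scalerA.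
rewrite [X in X *: _](_ : _ = 1); first by rewrite scale1r subKr.
rewrite -[RHS]ee dotZl dotZr D; ring.
Qed.

(** For a unit vector [e], the mirror image in the hyperplane x.e = l, written as an affine map so
    that [jet2_affine] applies. *)
Definition refl e l x := x *m refl_mx e + (2 * l) *: e.

Lemma reflE e l x : refl e l x = x - (2 * (dot x e - l)) *: e.
Proof.
rewrite /refl mulmx_refl -addrA -scaleNr -scalerDl; congr (_ + _);
  rewrite -[RHS]scaleNr; congr (_ *: _); ring.
Qed.

Lemma enorm_refl e l x : dot e e = 1 ->
  enorm (refl e l x) ^+ 2 = enorm x ^+ 2 - 4 * l * (dot x e - l).
Proof. by move=> ee; rewrite reflE !enorm_sqr !dotE (dotC e x) ee; ring. Qed.

Lemma enorm_refl_le e l x : dot e e = 1 -> 0 <= l -> l <= dot x e ->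
  enorm (refl e l x) <= enorm x.
Proof.
move=> ee l0 lx; rewrite -ler_sqr ?nnegrE ?enorm_ge0 // enorm_refl //.
by rewrite gerBl !mulr_ge0 // subr_ge0.
Qed.

Lemma refl_fix e l x : dot x e = l -> refl e l x = x.
Proof. by rewrite reflE => ->; rewrite subrr mulr0 scale0r subr0. Qed.

End Reflections.

(** * First contact and the minimum principle *)

Section MinimumPrinciple.
Variables (R : realType) (N : nat).
Implicit Types (x y : 'rV[R]_N) (w psi : 'rV[R]_N -> R) (D : set 'rV[R]_N).

Lemma compact_min w (K : set 'rV[R]_N) : compact K -> K !=set0 ->
  (forall x, K x -> {for x, continuous w}) ->
  exists2 x, K x & forall y, K y -> w x <= w y.
Proof.
move=> cK K0 cw; have [|x /set_mem Kx xm] := compact_EVT_min (f := w) K0 cK.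
  by apply: continuous_in_subspaceT => x /set_mem; exact: cw.
by exists x => // y Ky; apply: xm; rewrite inE.
Qed.

(* The hypothesis on compact sets says that w has nonnegative inferior limit on
   the boundary of D. *)
Lemma touching w psi D (c : R) x0 : 0 < c ->
  (forall y, D y -> c <= psi y) ->
  (forall eps : R, 0 < eps -> exists K, [/\ compact K,
      forall y, K y ->
        [/\ {for y, continuous w}, {for y, continuous psi} & 0 < psi y],
      forall y, D y -> - eps < w y \/ K y &
      forall y, K y -> w y < 0 -> D y]) ->
  D x0 -> w x0 < 0 ->
  exists x1 t, [/\ D x1, 0 < t, w x1 + t * psi x1 = 0 &
    forall y, D y -> 0 <= w y + t * psi y].
Proof.
move=> c0 psic bd Dx0 wx0.
have p0 y : D y -> 0 < psi y by move=> /psic; apply: lt_le_trans.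
pose t0 := - w x0 / psi x0; have t00 : 0 < t0 by rewrite divr_gt0 ?oppr_gt0 ?p0.
have wt0 : w x0 = - (t0 * psi x0) by rewrite /t0 divfK ?opprK // gt_eqF // p0.
(* With eps = t0 c, the quotient w / psi exceeds -t0, its value at [x0], at the points of [D]
   outside [K]; its minimum over [K] is therefore one over [D]. *)
have [K [cK Kc DK KD]] := bd _ (mulr_gt0 t00 c0).
have Kx0 : K x0.
  have [|//] := DK _ Dx0; rewrite wt0 ltrN2 ltr_pM2l //.
  by rewrite ltNge psic.
have [|x Kx|x1 Kx1 x1m] := @compact_min (fun y => w y / psi y) K cK; first by exists x0.
  have [cw cp px] := Kc _ Kx; apply: (continuousM cw); apply: continuousV => //.
  by rewrite gt_eqF.
have [_ _ px1] := Kc _ Kx1.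
have l1 : w x1 / psi x1 <= - t0.
  have := x1m _ Kx0; rewrite wt0 mulNr mulfK // gt_eqF // p0 //.
have w1 : w x1 < 0.
  suff : w x1 / psi x1 < 0 by rewrite pmulr_llt0 // invr_gt0.
  by apply: le_lt_trans l1 _; rewrite oppr_lt0.
have D1 : D x1 by exact: KD.
exists x1, (- (w x1 / psi x1)); split => //.
- by rewrite oppr_gt0; apply: le_lt_trans l1 _; rewrite oppr_lt0.
- by rewrite mulNr divfK ?subrr // gt_eqF.
move=> y Dy; have py := p0 _ Dy; have [wy|Ky] := DK _ Dy.
  rewrite mulNr subr_ge0; apply: (@le_trans _ _ (- t0 * psi y)).
    by rewrite ler_pM2r.
  apply: le_trans (ltW wy); rewrite mulNr lerN2 ler_pM2l //; exact: psic.
by rewrite mulNr subr_ge0 -ler_pdivlMr // x1m.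
Qed.

Definition eopen D := forall x, D x -> exists2 d : R, 0 < d & forall h, enorm h < d -> D (x + h).

Lemma eopen_ball y (r : R) : eopen [set x | enorm (x - y) < r].
Proof.
move=> x /= xr; exists (r - enorm (x - y)); first by rewrite subr_gt0.
move=> h hr; rewrite addrAC; apply: le_lt_trans (enormD _ _) _; lra.
Qed.

Lemma eopen_cap e (l : R) : dot e e = 1 ->
  eopen [set x : 'rV[R]_N | enorm x < 1 /\ l < dot x e].
Proof.
move=> ee x /= [x1 lx]; exists (Num.min (1 - enorm x) (dot x e - l)).
  by rewrite lt_min !subr_gt0 x1.
move=> h; rewrite lt_min => /andP[h1 h2]; split.
  apply: le_lt_trans (enormD _ _) _; lra.
have := cauchy_schwarz h e; rewrite (enormE e) ee sqrtr1 mulr1 ler_norml dotDl.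
by move=> /andP[]; lra.
Qed.

(** At a first contact, w + t psi has an interior minimum, where its Laplacian cannot be negative. A
    constant psi gives the usual principle; a psi with negative Laplacian can absorb a zero-order
    term where psi is small. *)
Lemma min_principle w psi D (c : R) : eopen D -> 0 < c ->
  (forall y, D y -> c <= psi y) ->
  (forall eps : R, 0 < eps -> exists K, [/\ compact K,
      forall y, K y ->
        [/\ {for y, continuous w}, {for y, continuous psi} & 0 < psi y],
      forall y, D y -> - eps < w y \/ K y &
      forall y, K y -> w y < 0 -> D y]) ->
  (forall x t, D x -> 0 < t -> w x + t * psi x = 0 ->
    exists p H q K, [/\ jet2 w x p H, jet2 psi x q K & \tr H + t * \tr K < 0]) ->
  forall x, D x -> 0 <= w x.
Proof.
move=> oD c0 psic bd neg x0 Dx0; rewrite leNgt; apply/negP => wx0.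
have [x [t [Dx t0 wx m]]] := touching c0 psic bd Dx0 wx0.
have [p [H [q [K [J1 J2]]]]] := neg _ _ Dx t0 wx.
have := jet2D J1 (jet2Z t J2) => /jet2_min; rewrite mxtraceD mxtraceZ.
move=> tr; apply/negP; rewrite -leNgt; apply: tr.
have [d d0 dD] := oD _ Dx; exists d => // h /dD /m; by rewrite wx.
Qed.

End MinimumPrinciple.

(** * Taylor's formula and the strong minimum principle *)

Section Taylor.
Variable R : realType.
Implicit Types (F dF : R -> R) (s k : R).

Lemma is_derive_normP (V : normedModType R) (f : V -> R) x w (d : R) :
  is_derive x w f d <->
  forall e : R, 0 < e -> exists2 r, 0 < r & forall k : R, `|k| < r ->
    `|f (k *: w + x) - f x - d * k| <= e * `|k|.
Proof.
have key (e k : R) : k != 0 ->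
    (`|d - k^-1 *: (f (k *: w + x) - f x)| <= e) =
    (`|f (k *: w + x) - f x - d * k| <= e * `|k|).
  move=> k0; rewrite -[RHS](@ler_pM2r _ `|k|^-1) ?invr_gt0 ?normr_gt0 //.
  rewrite mulfK ?normr_eq0 // -normfV -normrM mulrBl mulfK // distrC.
  by congr (`|_ - _| <= _); rewrite mulrC.
split=> [[fd dfd] e e0|H].
  move/cvgrPdist_le: fd => /(_ e e0); rewrite -/(derive f x w) dfd /dnbhs /=.
  move=> /nbhs_normP[r /= r0 rP].
  exists r => // k kr; have [->|k0] := eqVneq k 0.
    by rewrite scale0r add0r mulr0 subr0 subrr !normr0 mulr0.
  have := rP k; rewrite /= sub0r normrN => /(_ kr k0).
  by rewrite -key.
have C : k^-1 *: ((f \o shift x) (k *: w) - f x) @[k --> 0^'] --> d.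
  apply/cvgrPdist_le => e e0; have [r r0 rP] := H _ e0.
  rewrite /dnbhs /=; apply/nbhs_normP; exists r => // k /=.
  by rewrite sub0r normrN => kr k0; rewrite key // rP.
by apply: DeriveDef; [apply/cvg_ex; exists d|apply: cvg_lim].
Qed.

Lemma is_derive1_normP F s (d : R) : is_derive s 1 F d <->
  forall e : R, 0 < e -> exists2 r, 0 < r & forall k : R, `|k| < r ->
    `|F (s + k) - F s - d * k| <= e * `|k|.
Proof.
have E k : k *: (1 : R) + s = s + k by rewrite /GRing.scale /= mulr1 addrC.
split=> [H e e0|H].
  have [r r0 rP] := (is_derive_normP F s 1 d).1 H _ e0.
  by exists r => // k /rP; rewrite E.
apply/(is_derive_normP F s 1 d) => e /H[r r0 rP].
by exists r => // k /rP; rewrite E.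
Qed.

Lemma mvt_le F dF (a b d : R) : a <= b ->
  (forall x, a <= x <= b -> is_derive x 1 F (dF x)) ->
  (forall x, a <= x <= b -> `|dF x| <= d) ->
  `|F b - F a| <= d * (b - a).
Proof.
move=> ab Fd dFd.
have Fd' x : x \in `]a, b[%R -> is_derive x 1 F (dF x).
  rewrite in_itv /= => /andP[ax xb]; apply: Fd; apply/andP; split; exact: ltW.
have Fc : {within `[a, b], continuous F}.
  apply: derivable_within_continuous => y; rewrite in_itv /= => yab.
  by have [] := Fd _ yab.
have [c cab ->] := MVT_segment ab Fd' Fc.
rewrite normrM (@ger0_norm _ (b - a)) ?subr_ge0 // ler_wpM2r ?subr_ge0 //.
by apply: dFd; move: cab; rewrite in_itv.
Qed.

Lemma mvt_le_norm F dF s k (d : R) :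
  (forall x, `|x| <= `|k| -> is_derive (s + x) 1 F (dF (s + x))) ->
  (forall x, `|x| <= `|k| -> `|dF (s + x)| <= d) ->
  `|F (s + k) - F s| <= d * `|k|.
Proof.
move=> Fd dFd; have [k0|k0] := leP 0 k.
  rewrite (ger0_norm k0) in Fd dFd *; rewrite -[X in d * X](addrK s) [k + s]addrC.
  apply: (@mvt_le F dF); first by rewrite lerDl.
    move=> x /andP[sx xk]; rewrite -(subrKC s x); apply: Fd; rewrite ger0_norm; lra.
  move=> x /andP[sx xk]; rewrite -(subrKC s x); apply: dFd; rewrite ger0_norm; lra.
rewrite (ltr0_norm k0) in Fd dFd *; rewrite distrC.
rewrite [X in d * X](_ : _ = s - (s + k)); last by rewrite opprD addNKr.
apply: (@mvt_le F dF); first lra.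
  move=> x /andP[sx xk]; rewrite -(subrKC s x); apply: Fd; rewrite ler0_norm; lra.
move=> x /andP[sx xk]; rewrite -(subrKC s x); apply: dFd; rewrite ler0_norm; lra.
Qed.

(** [dF] is differentiable at s only, so the mean value theorem is applied once, to [F] minus its
    quadratic polynomial, whose derivative is o(|x|). *)
Lemma taylor2 F dF s (d2 r : R) : 0 < r ->
  (forall x, `|x| < r -> is_derive (s + x) 1 F (dF (s + x))) ->
  is_derive s 1 dF d2 ->
  forall e : R, 0 < e -> exists2 d, 0 < d & forall k, `|k| < d ->
    `|F (s + k) - F s - dF s * k - d2 * k ^+ 2 / 2| <= e * k ^+ 2.
Proof.
move=> r0 Fd /is_derive1_normP dFd e e0.
have [d d0 dP] := dFd _ e0.
exists (Num.min d r); first by rewrite lt_min d0.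
move=> k; rewrite lt_min => /andP[kd kr].
pose P x := F x - dF s * x - d2 / 2 * (x - s) ^+ 2.
have PE : F (s + k) - F s - dF s * k - d2 * k ^+ 2 / 2 = P (s + k) - P s.
  by rewrite /P; field.
have eE : e * k ^+ 2 = e * `|k| * `|k|.
  by rewrite -mulrA -normrM -expr2 ger0_norm ?sqr_ge0.
rewrite PE eE.
apply: (@mvt_le_norm P (fun x => dF x - dF s - d2 * (x - s))) => x xk.
  have FD : is_derive (s + x) 1 F (dF (s + x)) by apply: Fd; exact: le_lt_trans kr.
  apply: is_derive_eq.
  by rewrite /GRing.scale /=; field.
apply: (@le_trans _ _ (e * `|x|)); last by rewrite ler_pM2l.
rewrite (_ : s + x - s = x); last by rewrite addrAC subrr add0r.
by apply: dP; exact: le_lt_trans kd.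
Qed.

End Taylor.

(** * Hopf's barrier and the strong minimum principle *)

Section StrongMinimum.
Variables (R : realType) (N : nat).
Implicit Types (x y p : 'rV[R]_N) (H : 'M[R]_N) (w : 'rV[R]_N -> R).

Lemma compact_cball y (r : R) : compact [set x : 'rV[R]_N | enorm (x - y) <= r].
Proof.
apply: (@subclosed_compact _ _ [set x : 'rV[R]_N | enorm x <= r + enorm y]).
- apply: (@closed_comp _ _ (fun x => enorm (x - y)) [set s | s <= r]); last exact: closed_le.
  move=> x _; apply: (@continuous_comp _ _ _ (fun x => x - y) (@enorm R N)).
    by apply: continuousB; [exact: id|exact: cst_continuous].
  exact: continuous_enorm.
- exact: compact_ball.
- by move=> x /= xr; have := enormB x y; lra.
Qed.

Lemma jet2_gauss y x (al : R) :
  exists p H, jet2 (fun z => expR (- al * dot (z - y) (z - y))) x p H /\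
    \tr H = expR (- al * dot (x - y) (x - y)) *
            (4 * al ^+ 2 * dot (x - y) (x - y) - 2 * al *+ N).
Proof.
set s := dot (x - y) (x - y).
have De (z : R) : is_derive z 1 (fun t : R => expR (- al * t)) (- al * expR (- al * z)).
  have D1 : is_derive z 1 (fun t : R => - al * t) (- al).
    by apply: is_derive_eq; rewrite /GRing.scale /=; ring.
  by apply: (is_derive_eq (is_derive1_comp (is_derive_expR _) D1)); ring.
have De2 : is_derive s 1 (fun t => - al * expR (- al * t)) (al ^+ 2 * expR (- al * s)).
  by apply: is_derive_eq; rewrite /GRing.scale /=; ring.
have := jet2_comp (jet2_sqdist y x) (taylor2 ltr01 (fun t _ => De (s + t)) De2).
move=> J; eexists; eexists; split; first exact: J.
rewrite mxtraceD !mxtraceZ mxtrace_scalar mxtrace_tr_mul enormZ exprMn enorm_sqr -/s.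
rewrite real_normK ?num_real // -(mulr_natr 2) -(mulr_natr (2 * al)); ring.
Qed.

(* Hopf's barrier exp (-al |x-y|^2) - exp (-al rho^2) in the annulus
   r <= |x - y| < rho. *)
Lemma strong_min_ball w y (rho C : R) : 0 < rho -> 0 <= C ->
  (forall x, enorm (x - y) < rho -> 0 <= w x) ->
  (forall x, enorm (x - y) < rho -> exists p H, jet2 w x p H /\ \tr H <= C * w x) ->
  0 < w y -> forall x, enorm (x - y) < rho -> 0 < w x.
Proof.
move=> rho0 C0 w0 wJ wy.
have : {for y, continuous w}.
  have [|p [H [J _]]] := wJ y; first by rewrite subrr enorm0.
  exact: jet2_continuous J.
have wy2 : 0 < w y / 2 by rewrite divr_gt0.
move=> /continuous_atP/(_ _ wy2)[r r0 wr].
(* Large enough that for |x - y| >= r the Laplacian of the Gaussian exceeds C times the Gaussian. *)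
pose al := 1 + (C + 2 *+ N + 1) / (4 * r ^+ 2).
have nn : 0 <= (2 *+ N : R) by rewrite mulrn_wge0.
have al1 : 1 <= al.
  rewrite lerDl; apply: divr_ge0; first lra.
  by rewrite mulr_ge0 ?sqr_ge0.
have alr : C + 2 *+ N + 1 <= 4 * al * r ^+ 2.
  have -> : 4 * al * r ^+ 2 = 4 * r ^+ 2 + (C + 2 *+ N + 1).
    by rewrite /al; field; rewrite gt_eqF.
  by rewrite lerDr mulr_ge0 // sqr_ge0.
pose E0 := expR (- al * rho ^+ 2).
pose b x := expR (- al * dot (x - y) (x - y)) - E0.
pose z x := w x - w y / 2 * b x.
have E00 : 0 < E0 by exact: expR_gt0.
have b_le x : b x <= 1.
  rewrite /b; have : expR (- al * dot (x - y) (x - y)) <= 1.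
    rewrite -[leRHS]expR0 ler_expR mulNr oppr_le0 mulr_ge0 ?dot_ge0 //; lra.
  lra.
have b_gt0 x : enorm (x - y) < rho -> 0 < b x.
  move=> xr; rewrite subr_gt0 ltr_expR !mulNr ltrN2 ltr_pM2l; last lra.
  by rewrite -enorm_sqr ltr_sqr ?nnegrE ?enorm_ge0 // ltW.
have zJ x : enorm (x - y) < rho -> exists p H, jet2 z x p H /\
    \tr H <= C * w x - w y / 2 * (expR (- al * dot (x - y) (x - y)) *
            (4 * al ^+ 2 * dot (x - y) (x - y) - 2 * al *+ N)).
  move=> /wJ[p [H [J T]]]; have [q [K [Jb Tb]]] := jet2_gauss y x al.
  exists (p - (w y / 2) *: (q - 0)), (H - (w y / 2) *: (K - 0)); split.
    exact/jet2B/jet2Z/jet2B/jet2_cst.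
  by rewrite !subr0 -Tb raddfB /= mxtraceZ lerD2r.
suff zp x : enorm (x - y) < rho -> 0 <= z x.
  move=> x xr; have := zp _ xr; rewrite subr_ge0; apply: lt_le_trans.
  by rewrite mulr_gt0 // b_gt0.
move: x; apply: (@min_principle _ _ z (fun=> 1) [set x | enorm (x - y) < rho] 1) => //.
- exact: eopen_ball.
(* [b] is at most al * 2 rho * (rho - |x - y|), so beyond radius [r'] it lowers [z] by less than
   eps. *)
- move=> eps eps0; pose r' := rho - eps / (w y / 2 * (al * (2 * rho))).
  have k0 : 0 < w y / 2 * (al * (2 * rho)).
    by rewrite mulr_gt0 // mulr_gt0 // ?mulr_gt0 //; lra.
  have r'r : r' < rho by rewrite gtrBl divr_gt0.
  exists [set x | enorm (x - y) <= r']; split.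
  + exact: compact_cball.
  + move=> x /= xr; split => //; last exact: cst_continuous.
    have [|p [H [J _]]] := zJ x; first exact: le_lt_trans r'r.
    exact: jet2_continuous J.
  + move=> x /= xr; have [|xr'] := leP (enorm (x - y)) r'; [by right|left].
    have wx := w0 _ xr.
    have n0 := enorm_ge0 (x - y).
    have bx : b x <= al * (2 * rho) * (rho - enorm (x - y)).
      have e1 := expR_ge1Dx (- al * (rho ^+ 2 - dot (x - y) (x - y))).
      have e2 : expR (- al * dot (x - y) (x - y)) <= 1.
        rewrite -[leRHS]expR0 ler_expR mulNr oppr_le0 mulr_ge0 ?dot_ge0 //; lra.
      have e3 : E0 = expR (- al * dot (x - y) (x - y)) *
                     expR (- al * (rho ^+ 2 - dot (x - y) (x - y))).
        by rewrite -expRD /E0; congr expR; ring.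
      rewrite /b e3; move: e1 e2 (expR_gt0 (- al * dot (x - y) (x - y))).
      rewrite -enorm_sqr; set E := expR (- al * _ ^+ 2); set F := expR _; set n := enorm _ in xr n0 *.
      move=> F1 E1 E2.
      have A1 : E - E * F <= E * (al * (rho ^+ 2 - n ^+ 2)) by nra.
      have n2 : 0 <= rho ^+ 2 - n ^+ 2 by nra.
      have A2 : E * (al * (rho ^+ 2 - n ^+ 2)) <= al * (rho ^+ 2 - n ^+ 2).
        by apply: ler_piMl => //; apply: mulr_ge0 => //; lra.
      apply: le_trans (le_trans A1 A2) _.
      rewrite -mulrA ler_pM2l; last lra.
      by rewrite subr_sqr mulrC ler_wpM2r //; lra.
    have : w y / 2 * b x <= w y / 2 * (al * (2 * rho)) * (rho - enorm (x - y)).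
      rewrite -(mulrA (w y / 2)); apply: ler_wpM2l; [exact: ltW|exact: bx].
    have : w y / 2 * (al * (2 * rho)) * (rho - enorm (x - y)) < eps.
      rewrite mulrC -ltr_pdivlMr //; move: xr'; rewrite /r'; lra.
    rewrite /z; lra.
  + by move=> x /= xr _; exact: le_lt_trans r'r.
move=> x t /= xr t0; rewrite mulr1 => zx.
have [p [H [J T]]] := zJ _ xr.
exists p, H, 0, 0; split => //; first exact: jet2_cst.
rewrite raddf0 mulr0 addr0; apply: le_lt_trans T _.
(* Within radius r, w exceeds w y / 2 while the barrier is at most 1; a negative value of [z] can
   only occur in the annulus. *)
have rx : r <= enorm (x - y).
  rewrite leNgt; apply/negP => /wr; rewrite subrKC ltr_norml => /andP[w1 _].
  have : w y / 2 * b x <= w y / 2 * 1 by apply: ler_wpM2l; [exact: ltW|exact: b_le].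
  move: zx; rewrite /z; lra.
have q2 : r ^+ 2 <= dot (x - y) (x - y).
  by rewrite -enorm_sqr ler_sqr ?nnegrE ?enorm_ge0 // ltW.
set E := expR _; have Ep : 0 < E by exact: expR_gt0.
(* Where [z] is negative, w lies below w y / 2 times the Gaussian, so C w cannot compensate for the
   Laplacian of the barrier. *)
have wx : w x <= w y / 2 * E.
  have : w y / 2 * b x <= w y / 2 * E by apply: ler_wpM2l; [exact: ltW|rewrite /b -/E gerBl ltW].
  move: zx; rewrite /z; lra.
have C1 : C * w x <= C * (w y / 2 * E) by rewrite ler_wpM2l.
rewrite subr_lt0; apply: le_lt_trans C1 _.
rewrite mulrCA ltr_pM2l // mulrC ltr_pM2l //.
set q := dot _ _ in q2 *; rewrite -mulrnAr.
have : al * (C + 2 *+ N + 1) <= al * (4 * al * q).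
  rewrite ler_pM2l; last lra.
  by apply: le_trans alr _; rewrite ler_wpM2l //; lra.
have -> : 2 * (al *+ N) = al * (2 *+ N) by rewrite mulrnAr mulrC -mulrnAr.
nra.
Qed.

(** A chain of balls of radius rho centred on the segment, with steps shorter than rho, carries
    positivity from each centre to the next. *)
Lemma strong_min_segment w x0 x1 (rho C : R) : 0 < rho -> 0 <= C ->
  (forall t x, 0 <= t <= 1 -> enorm (x - (x0 + t *: (x1 - x0))) < rho ->
    0 <= w x /\ exists p H, jet2 w x p H /\ \tr H <= C * w x) ->
  0 < w x0 -> 0 < w x1.
Proof.
move=> rho0 C0 wP w0.
pose n := (Num.truncn (enorm (x1 - x0) / rho)).+1.
have n0 : 0 < n%:R :> R by rewrite ltr0n.
have nr : enorm (x1 - x0) / n%:R < rho.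
  rewrite ltr_pdivrMr // mulrC -ltr_pdivrMr //.
  exact: truncnS_gt.
have step k : (k <= n)%N -> 0 < w (x0 + (k%:R / n%:R) *: (x1 - x0)).
  elim: k => [_|k IH kn]; first by rewrite mul0r scale0r addr0.
  have kt : 0 <= (k%:R / n%:R : R) <= 1.
    by rewrite divr_ge0 //= ler_pdivrMr // mul1r ler_nat ltnW.
  apply: (@strong_min_ball w _ rho C rho0 C0 _ _ (IH (ltnW kn))).
  - by move=> x /(wP _ _ kt)[].
  - by move=> x /(wP _ _ kt)[].
  rewrite opprD addrACA subrr add0r -scalerBl enormZ -mulrBl -natrB // subSnn.
  by rewrite ger0_norm ?divr_ge0 // mul1r mulrC.
by have := step n (leqnn _); rewrite divff ?gt_eqF // scale1r subrKC.
Qed.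

End StrongMinimum.

(** * Large solutions of Lap v = h(v) *)

Section LargeSolution.
Variables (R : realType) (N : nat) (v : 'rV[R]_N -> R) (h : R -> R) (s0 delta : R).
Hypothesis N_gt0 : (0 < N)%N.
Hypothesis v_gt0 : forall x, enorm x < 1 -> 0 < v x.
Hypothesis v_jet : forall x, enorm x < 1 ->
  exists p H, jet2 v x p H /\ \tr H = h (v x).
Hypothesis v_blowup : forall M, exists2 r, 0 <= r < 1 &
  forall x, r < enorm x -> enorm x < 1 -> M < v x.
Hypotheses (s0_gt0 : 0 < s0) (delta_gt0 : 0 < delta).
Hypothesis h_gt0 : forall s, s0 <= s -> 0 < h s.
Hypothesis h_pow : forall sigma s, 0 <= sigma -> s0 <= s ->
  expR ((1 + delta) * sigma) * h s <= h (expR sigma * s).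
Hypothesis h_lip : forall M, exists2 C, 0 <= C &
  forall r s, 0 <= r -> r <= s -> s <= M -> `|h s - h r| <= C * (s - r).
Implicit Types (x y e : 'rV[R]_N) (r s t l : R).

(** * Bounds on v and monotonicity of h at large values *)

Lemma v_cont x : enorm x < 1 -> {for x, continuous v}.
Proof. by move=> /v_jet[p [H [J _]]]; exact: jet2_continuous J. Qed.

Lemma v_bounded r : 0 <= r < 1 -> exists2 M, 0 < M & forall x, enorm x <= r -> v x <= M.
Proof.
move=> /andP[r0 r1].
have [||x xr m] := @compact_min _ _ (fun x => - v x) _ (@compact_ball _ N r).
- by exists 0; rewrite /= enorm0.
- by move=> x /= xr; apply: continuousN; apply: v_cont; exact: le_lt_trans r1.
exists (v x) => [|y yr]; first by apply: v_gt0; exact: le_lt_trans r1.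
by rewrite -lerN2 m.
Qed.

Lemma h_mono s t : s0 <= s -> s <= t -> h s <= h t.
Proof.
move=> ss st; have sp : 0 < s by exact: lt_le_trans ss.
have ts : 1 <= t / s by rewrite ler_pdivlMr // mul1r.
have lt0 : 0 <= ln (t / s) by exact: ln_ge0.
have := h_pow lt0 ss; rewrite lnK ?posrE ?divr_gt0 ?(lt_le_trans sp) // divfK ?gt_eqF //.
apply: le_trans; apply: ler_peMl; first exact/ltW/h_gt0.
rewrite -[leLHS]expR0 ler_expR; by rewrite mulr_ge0 // addr_ge0 // ltW.
Qed.

(** Above [s0] the monotonicity of h gives the favourable sign, so the Lipschitz constant on [0, s0]
    serves for all arguments. *)
Lemma h_one_sided_lip : exists2 C, 0 <= C &
  forall s t, 0 <= s -> s <= t -> h s - h t <= C * (t - s).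
Proof.
have [C C0 CP] := h_lip s0; exists C => // s t ss st.
have [s0s|ss0] := leP s0 s.
  apply: (@le_trans _ _ 0); first by rewrite subr_le0 h_mono.
  by rewrite mulr_ge0 // subr_ge0.
have [s0t|ts0] := leP s0 t.
  have := CP _ _ ss (ltW ss0) (lexx _); rewrite distrC => /(le_trans (ler_norm _)).
  have := h_mono (lexx _) s0t; have : C * (s0 - s) <= C * (t - s).
    by rewrite ler_wpM2l // lerD2r.
  lra.
have := CP _ _ ss st (ltW ts0); rewrite distrC; exact: le_trans (ler_norm _).
Qed.

(* A dilation of v in which the lower order factor is absorbed by the
   superlinearity of h is a supersolution, infinite on a sphere smaller than the
   unit sphere. *)
Lemma dilation_compare r0 K (L : 'M[R]_N) sigma x : 0 <= r0 < 1 ->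
  (forall x, r0 < enorm x -> enorm x < 1 -> s0 < v x) -> 0 < K ->
  (forall x, enorm x <= r0 -> v x <= K * (1 - r0 ^+ 2)) ->
  L^T *m L = 1%:M -> 0 < sigma ->
  enorm x < (expR (delta / 2 * sigma))^-1 ->
  v x <= expR sigma * v (x *m (expR (delta / 2 * sigma) *: L)) +
         K * (1 - enorm x ^+ 2).
Proof.
move=> /andP[r00 r01] vs0 K0 vK LL sigma0.
set q := expR (delta / 2 * sigma); set c := expR sigma; move: x.
have q1 : 1 < q by rewrite /q -expR0 ltr_expR !mulr_gt0.
have c1 : 1 < c by rewrite /c -expR0 ltr_expR.
have c0 : 0 < c by lra.
have q0 : 0 < q by lra.
have qi : q^-1 < 1 by rewrite invf_lt1.
have nq y : enorm (y *m (q *: L)) = q * enorm y.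
  by rewrite -scalemxAr enormZ orth_enorm // ger0_norm // ltW.
have nq1 y : enorm y < q^-1 -> enorm (y *m (q *: L)) < 1.
  by move=> yq; rewrite nq mulrC -ltr_pdivlMr // div1r.
pose w y := (c * v (y *m (q *: L) + 0) + K * (1 - dot (y - 0) (y - 0))) - v y.
have J y : enorm y < q^-1 -> exists p H, jet2 w y p H /\
    \tr H = c * (q ^+ 2 * h (v (y *m (q *: L)))) + K * (0 - 2 *+ N) - h (v y).
  move=> yq; have y1 : enorm y < 1 by exact: lt_trans qi.
  have [p1 [H1 [J1 T1]]] := v_jet y1.
  have [p2 [H2 [J2 T2]]] := v_jet (nq1 _ yq).
  rewrite -(addr0 (y *m (q *: L))) in J2.
  have J3 := jet2Z c (jet2_affine J2).
  have J4 := jet2Z K (jet2B (jet2_cst 1 y) (jet2_sqdist 0 y)).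
  have := jet2B (jet2D J3 J4) J1.
  eexists; eexists; split; first by eassumption.
  rewrite !(mxtraceD, mxtraceZ, raddfN, raddf0) /= mxtrace_scalar T1.
  congr (c * _ + K * _ - _).
  by rewrite linearZ /= -!scalemxAl -scalemxAr !mxtraceZ mxtrace_orth // T2 mulrA expr2.
have wc y : enorm y < q^-1 -> {for y, continuous w}.
  by move=> /J[p [H [JH _]]]; exact: jet2_continuous JH.
move=> x xq; suff : 0 <= w x by rewrite /w subr_ge0 addr0 subr0 enorm_sqr.
move: (xq); rewrite -[x in enorm x]subr0.
apply: (@min_principle _ _ w (fun=> 1) [set y | enorm (y - 0) < q^-1] 1) => //.
- exact: eopen_ball.
- move=> eps eps0.
  (* [M] bounds v on the closed ball of radius 1/q, while v at the dilated point exceeds [M] near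
     the boundary of that ball: w is positive there. *)
  have [M M0 MP] : exists2 M, 0 < M & forall y, enorm y <= q^-1 -> v y <= M.
    by apply: v_bounded; rewrite qi invr_ge0 ltW.
  have [r /andP[r0' r1] vr] := v_blowup M.
  have rq y : enorm y <= q^-1 * r -> enorm y < q^-1.
    by move=> /le_lt_trans; apply; rewrite gtr_pMr // invr_gt0.
  exists [set y | enorm y <= q^-1 * r]; split.
  + exact: compact_ball.
  + by move=> y /= /rq yq; split => //; [exact: wc|exact: cst_continuous].
  + move=> y /=; rewrite subr0 => yq; have [yr|yr] := leP (enorm y) (q^-1 * r); [by right|left].
    have : M < v (y *m (q *: L)).
      by apply: vr; [rewrite nq mulrC -ltr_pdivrMr // mulrC|exact: nq1].
    have := MP _ (ltW yq); have y2 : enorm y ^+ 2 < 1.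
      by rewrite expr_lt1 ?enorm_ge0 //; exact: lt_trans qi.
    rewrite /w addr0 subr0 -enorm_sqr.
    have : 0 <= K * (1 - enorm y ^+ 2) by apply: mulr_ge0; [exact: ltW|rewrite subr_ge0; exact: ltW].
    nra.
  + by move=> y /= /rq; rewrite subr0.
move=> y t /=; rewrite subr0 => yq t0; rewrite mulr1 => wy.
have [p [H [JH TH]]] := J _ yq.
exists p, H, 0, 0; split => //; first exact: jet2_cst.
rewrite raddf0 mulr0 addr0 TH.
have y1 : enorm y < 1 by exact: lt_trans qi.
have vq := v_gt0 (nq1 _ yq).
have ny0 := enorm_ge0 y.
(* Up to radius [r0] the term K (1 - |y|^2) dominates v, so a negative value of w puts y, and with
   it the dilated point, where v > s0 and [h_pow] is available. *)
have yr0 : r0 < enorm y.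
  rewrite ltNge; apply/negP => yr0.
  have := vK _ yr0; have : K * (1 - r0 ^+ 2) <= K * (1 - enorm y ^+ 2).
    by rewrite ler_pM2l // lerD2l lerN2 ler_sqr ?nnegrE.
  move: wy; rewrite /w addr0 subr0 -enorm_sqr; have := mulr_gt0 c0 vq; lra.
have sq : s0 <= v (y *m (q *: L)).
  by apply/ltW/vs0; [rewrite nq; apply: lt_le_trans yr0 _; apply: ler_peMl => //; exact: ltW|exact: nq1].
have := h_pow (ltW sigma0) sq.
(* The exponents of [c] and [q] are tuned so that the factor c q^2 of the Laplacian is the one in
   [h_pow]. *)
have -> : expR ((1 + delta) * sigma) = c * q ^+ 2.
  by rewrite /c /q expr2 -!expRD; congr expR; field.
rewrite -/c => h1.
have h2 : h (c * v (y *m (q *: L))) <= h (v y).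
  apply: h_mono; first by apply: le_trans sq _; apply: ler_peMl; exact: ltW.
  have : 0 <= K * (1 - enorm y ^+ 2).
    by apply: mulr_ge0; [exact: ltW|apply: ltW; rewrite subr_gt0 expr_lt1].
  move: wy; rewrite /w addr0 subr0 -enorm_sqr; lra.
(* The strict sign comes from the Laplacian -2NK of the additive term. *)
have : 0 < K * (2 *+ N) by rewrite mulr_gt0 // pmulrn_lgt0.
lra.
Qed.

(** K = M / (1 - r0^2), with M a bound for v up to radius r0, depends neither on sigma nor on the
    orthogonal map, so sigma can tend to 0 at a fixed y: a strict violation would persist for small
    sigma. *)
Lemma rotation_compare : exists2 K, 0 < K &
  forall x y, enorm y < 1 -> enorm x = enorm y -> v y <= v x + K * (1 - enorm y ^+ 2).
Proof.
have [r0 r01 vs0] := v_blowup s0.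
have [M M0 vM] := v_bounded r01.
have r02 : 0 < 1 - r0 ^+ 2 by case/andP: r01 => ? ?; rewrite subr_gt0 expr_lt1.
have K0 : 0 < M / (1 - r0 ^+ 2) by exact: divr_gt0.
exists (M / (1 - r0 ^+ 2)) => // x y y1 /esym/exists_orth_map[L LL <-].
rewrite leNgt; apply/negP => lt.
pose F s := expR s * v (expR (delta / 2 * s) *: (y *m L)).
have ce : continuous (fun s : R => expR (delta / 2 * s)).
  move=> s; apply: (@continuous_comp _ _ _ (fun s => delta / 2 * s) expR).
    by apply: continuousM; [exact: cst_continuous|exact: id].
  exact: continuous_expR.
have F0 : {for 0, continuous F}.
  apply: continuousM; first exact: continuous_expR.
  apply: (@continuous_comp _ _ _ (fun s => expR (delta / 2 * s) *: (y *m L)) v).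
    by apply: continuousZl; exact: ce.
  apply: v_cont; rewrite mulr0 expR0 scale1r orth_enorm //.
have n1 : \forall s \near 0, F s < v y - M / (1 - r0 ^+ 2) * (1 - enorm y ^+ 2).
  apply: (@cvgr_lt _ _ _ _ _ _ F0).
  by rewrite /F mulr0 expR0 mul1r scale1r; lra.
have n2 : \forall s \near 0, expR (delta / 2 * s) * enorm y < 1.
  have cy : {for 0, continuous (fun s : R => expR (delta / 2 * s) * enorm y)}.
    by apply: continuousM; [exact: ce|exact: cst_continuous].
  by apply: (@cvgr_lt _ _ _ _ _ _ cy); rewrite mulr0 expR0 mul1r.
have /nbhs_normP[d /= d0 Pd] : \forall s \near 0, F s < v y - M / (1 - r0 ^+ 2) * (1 - enorm y ^+ 2) /\
   expR (delta / 2 * s) * enorm y < 1 by exact: filterI n1 n2.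
pose s := d / 2; have sp : 0 < s by rewrite divr_gt0.
have [|Fs sy] := Pd s.
  by rewrite /= sub0r normrN gtr0_norm // /s; lra.
have : enorm y < (expR (delta / 2 * s))^-1.
  by rewrite -div1r ltr_pdivlMr ?expR_gt0 // mulrC.
move=> /(dilation_compare r01 vs0 K0 _ LL sp).
rewrite divfK ?gt_eqF // => /(_ vM); move: Fs; rewrite /F -scalemxAr; lra.
Qed.

(** The maximum of v over the closed ball of radius |x| is not interior, since v > s0 there would
    make the Laplacian h(v) positive; on the sphere of radius |x| [rotation_compare] applies. *)
Lemma near_radial_mono : exists r0 K, [/\ 0 <= r0 < 1, 0 < K,
  forall x, r0 < enorm x -> enorm x < 1 -> s0 < v x &
  forall x y, r0 < enorm x -> enorm x < 1 -> enorm y <= enorm x ->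
    v y <= v x + K * (1 - enorm x ^+ 2)].
Proof.
have [K K0 KP] := rotation_compare.
have [r0 r01 vs0] := v_blowup s0.
exists r0, K; split => // x y xr x1 yx.
have [||z /= zx m] := @compact_min _ _ (fun x => - v x) _ (@compact_ball _ N (enorm x)).
- by exists 0; rewrite /= enorm0 enorm_ge0.
- by move=> z /= zr; apply: continuousN; apply: v_cont; exact: le_lt_trans x1.
have vz u : enorm u <= enorm x -> v u <= v z by move=> ux; rewrite -lerN2 m.
apply: le_trans (vz _ yx) _.
move: zx; rewrite le_eqVlt => /orP[/eqP zx|zx].
  by rewrite -zx; apply: KP; rewrite ?zx.
have z1 := lt_trans zx x1.
have [p [H [J T]]] := v_jet z1.
suff : \tr H <= 0.
  rewrite T leNgt h_gt0 //; apply: le_trans (vz _ (lexx _)); exact/ltW/vs0.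
have := jet2Z (-1) J => /jet2_min; rewrite mxtraceZ => T0; rewrite -oppr_ge0 -mulN1r; apply: T0.
exists (enorm x - enorm z); first by rewrite subr_gt0.
move=> k kx; rewrite !mulN1r lerN2; apply: vz; apply: le_trans (enormD _ _) _; lra.
Qed.

(** * The difference between v and its reflection *)

Definition refl_diff e l x := v x - v (refl e l x).

Lemma refl_in_ball e l x : dot e e = 1 -> 0 <= l -> l <= dot x e -> enorm x < 1 ->
  enorm (refl e l x) < 1.
Proof. by move=> ee l0 lx; apply: le_lt_trans; exact: enorm_refl_le. Qed.

Lemma refl_diff_jet e l x : dot e e = 1 -> 0 <= l -> l <= dot x e -> enorm x < 1 ->
  exists p H, jet2 (refl_diff e l) x p H /\ \tr H = h (v x) - h (v (refl e l x)).
Proof.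
move=> ee l0 lx x1; have [p1 [H1 [J1 T1]]] := v_jet x1.
have [p2 [H2 [J2 T2]]] := v_jet (refl_in_ball ee l0 lx x1).
exists (p1 - p2 *m (refl_mx e)^T), (H1 - refl_mx e *m H2 *m (refl_mx e)^T); split.
  exact/jet2B/jet2_affine.
by rewrite raddfB /= mxtrace_orth ?refl_mx_orth // T1 T2.
Qed.

(** The strong minimum principle needs one point of strict inequality. It is r e with r close to 1:
    v is large there, while the mirror image stays in a smaller ball. *)
Lemma refl_diff_gt0 e l : dot e e = 1 -> 0 < l < 1 ->
  (forall x, enorm x < 1 -> l < dot x e -> 0 <= refl_diff e l x) ->
  forall x, enorm x < 1 -> l < dot x e -> 0 < refl_diff e l x.
Proof.
move=> ee /andP[l0 l1] w0 x x1 lx.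
have e1 : enorm e = 1 by rewrite enormE ee sqrtr1.
(* The mirror image of r e is (2l - r) e, and for l < r < 1 this number lies between 2l - 1 and
   l. *)
pose r' := Num.max l (1 - 2 * l).
have [M M0 vM] : exists2 M, 0 < M & forall y, enorm y <= r' -> v y <= M.
  apply: v_bounded; rewrite /r' le_max gt_max (ltW l0) l1 /=.
  by rewrite gtrBl mulr_gt0.
have [r1 /andP[r10 r11] vr1] := v_blowup M.
pose r := (Num.max r1 l + 1) / 2.
have [rl rr1 r_1] : [/\ l < r, r1 < r & r < 1].
  have m1 : Num.max r1 l < 1 by rewrite gt_max r11.
  have m2 : r1 <= Num.max r1 l by rewrite le_max lexx.
  have m3 : l <= Num.max r1 l by rewrite le_max lexx orbT.
  rewrite /r; split; lra.
have re : enorm (r *: e) = r by rewrite enormZ e1 mulr1 gtr0_norm // (lt_trans l0).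
have re1 : enorm (r *: e) < 1 by rewrite re.
have lre : l < dot (r *: e) e by rewrite dotZl ee mulr1.
have wre : 0 < refl_diff e l (r *: e).
  rewrite subr_gt0; apply: (@le_lt_trans _ _ M); last by apply: vr1; rewrite re.
  apply: vM; rewrite reflE dotZl ee mulr1 -scalerBl enormZ e1 mulr1 /r' le_max.
  by have [a0|a0] := leP 0 (r - 2 * (r - l)); apply/orP;
    [left; rewrite ger0_norm //; lra|right; rewrite ltr0_norm //; lra].
(* Half the least distance of both endpoints to the sphere and to the hyperplane; by convexity the
   rho-neighbourhood of the segment stays at distance at least rho from both. *)
pose rho := Num.min (Num.min (1 - enorm x) (1 - r)) (Num.min (dot x e - l) (r - l)) / 2.
have [R0 R1 R2 R3 R4] : [/\ 0 < rho, 2 * rho <= 1 - enorm x, 2 * rho <= 1 - r,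
    2 * rho <= dot x e - l & 2 * rho <= r - l].
  rewrite /rho; set m := Num.min _ _.
  have [m0 m1 m2 m3 m4] : [/\ 0 < m, m <= 1 - enorm x, m <= 1 - r,
      m <= dot x e - l & m <= r - l].
    by rewrite /m !ge_min !lexx !orbT !lt_min !subr_gt0 x1 r_1 lx rl.
  split; lra.
have [M' M'0 vM'] : exists2 M, 0 < M & forall y, enorm y <= 1 - rho -> v y <= M.
  by apply: v_bounded; have := enorm_ge0 x; lra.
have [C C0 CP] := h_lip M'.
apply: (@strong_min_segment _ _ _ (r *: e) x rho C) => // t y /andP[t0 t1] yt.
set z := r *: e + t *: (x - r *: e) in yt.
have zE : z = (1 - t) *: (r *: e) + t *: x.
  by rewrite /z scalerBr scalerBl scale1r addrA addrAC.
have nz : enorm z <= (1 - t) * r + t * enorm x.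
  rewrite zE; apply: le_trans (enormD _ _) _; rewrite !enormZ e1 mulr1.
  by rewrite !ger0_norm ?subr_ge0 // ltW // (lt_trans l0).
have dz : dot z e = (1 - t) * r + t * dot x e by rewrite zE !dotE ee mulr1.
have ny : enorm y <= 1 - rho.
  rewrite -(subrK z y); apply: le_trans (enormD _ _) _; nra.
have ly : l < dot y e.
  rewrite -(subrK z y) dotDl dz.
  have := cauchy_schwarz (y - z) e; rewrite e1 mulr1 ler_norml => /andP[D1 _]; nra.
have y1 : enorm y < 1 by lra.
have wy := w0 _ y1 ly; split => //.
have [p [H [J T]]] := refl_diff_jet ee (ltW l0) (ltW ly) y1.
exists p, H; split => //; rewrite T.
have vyl := v_gt0 (refl_in_ball ee (ltW l0) (ltW ly) y1).
(* Both values of v lie in [0, M'] and the reflected one is the smaller, so the Lipschitz bound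
   controls the Laplacian by C times the difference. *)
apply: le_trans (ler_norm _) _; apply: CP; [exact: ltW| |exact: vM'].
by rewrite -subr_ge0.
Qed.

(* The comparison function 2z - z^2/2 with z = x.e - l + eta has Laplacian -1 and
   is small where z is, so that it controls both the narrow slab next to the
   hyperplane and the shell where h is monotone. *)
Lemma refl_diff_ge0_off_compact : exists r0 eta0, [/\ 0 <= r0 < 1, 0 < eta0 &
  forall e l eta, dot e e = 1 -> 0 < l -> 0 < eta <= eta0 ->
  (forall x, enorm x <= r0 -> l + 2 * eta <= dot x e -> 0 <= refl_diff e l x) ->
  forall x, enorm x < 1 -> l < dot x e -> 0 <= refl_diff e l x].
Proof.
have [r0 [K [/andP[r00 r01] K0 vs0 nearK]]] := near_radial_mono.
have [C C0 osl] := h_one_sided_lip.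
(* In the slab l < x.e < l + 2 eta one has z < 3 eta, hence psi < 6 eta; [eta0] is chosen so that C
   * 6 eta < 1. *)
pose eta0 := 1 / (6 * C + 6); have eta00 : 0 < eta0 by rewrite divr_gt0 //; lra.
exists r0, eta0; split; rewrite ?r00 //.
move=> e l eta ee l0 /andP[e0 ee0] wK.
have e1 : enorm e = 1 by rewrite enormE ee sqrtr1.
have Ceta : C * (6 * eta) < 1.
  have : 6 * (C + 1) * eta <= 6 * (C + 1) * eta0 by rewrite ler_pM2l //; lra.
  have -> : 6 * (C + 1) * eta0 = 1 by rewrite /eta0; field; lra.
  lra.
(* This keeps z below 2, where 2z - z^2/2 >= z >= eta. *)
have eta1 : eta <= 1.
  by apply: le_trans ee0 _; rewrite /eta0 ler_pdivrMr; lra.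
have dot1 x : enorm x < 1 -> dot e x < 1.
  by move=> x1; apply: le_lt_trans (dot_le _ _) _; rewrite e1 mul1r.
pose psi x := 2 * (dot e x + (eta - l)) - (dot e x + (eta - l)) ^+ 2 / 2.
have Jpsi x : exists q M, jet2 psi x q M /\ \tr M = -1.
  pose F s := 2 * (s + (eta - l)) - (s + (eta - l)) ^+ 2 / 2.
  have := @jet2_comp _ _ F (2 - (dot e x + (eta - l))) (-1) _ _ _ _ (jet2_dot e x).
  move=> J; eexists; eexists; split; first apply: J.
    move=> eps eps0; exists 1 => // k _; rewrite [X in `|X|](_ : _ = 0).
      by rewrite normr0 mulr_ge0 ?sqr_ge0 // ltW.
    by rewrite /F; field.
  by rewrite scaler0 add0r mxtraceZ mxtrace_tr_mul e1 expr1n mulr1.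
have psi_ge x : enorm x < 1 -> l <= dot x e -> eta <= psi x.
  move=> /dot1 x1; rewrite dotC => lx; rewrite /psi; nra.
have wc x : enorm x < 1 -> l <= dot x e -> {for x, continuous (refl_diff e l)}.
  move=> x1 lx; have [p [H [J _]]] := refl_diff_jet ee (ltW l0) lx x1.
  exact: jet2_continuous J.
move=> x x1 lx; have : [set x | enorm x < 1 /\ l < dot x e] x by [].
move: x {x1 lx}; apply: (@min_principle _ _ _ psi _ eta) => //.
- exact: eopen_cap.
- by move=> y /= [y1 ly]; apply: psi_ge => //; exact: ltW.
(* Beyond [r'] the error K (1 - |y|^2) of [near_radial_mono] is below eps, corner of the cap
   included. *)
- move=> eps eps0; pose r' := Num.max r0 (1 - eps / (4 * K)).
  have K4 : 0 < 4 * K by rewrite mulr_gt0.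
  have r'1 : r' < 1 by rewrite gt_max r01 gtrBl divr_gt0.
  exists [set x | enorm x <= r' /\ l <= dot e x]; split.
  + exact: compact_cap.
  + move=> y /= [yr ly]; have y1 : enorm y < 1 by exact: le_lt_trans r'1.
    rewrite dotC in ly; split; first exact: wc.
      by have [q [M [J _]]] := Jpsi y; exact: jet2_continuous J.
    by apply: lt_le_trans e0 _; exact: psi_ge.
  + move=> y /= [y1 ly]; have [yr|] := leP (enorm y) r'.
      by right; rewrite dotC; split => //; exact: ltW.
    rewrite gt_max => /andP[yr0 yK]; left.
    have := nearK _ _ yr0 y1 (enorm_refl_le ee (ltW l0) (ltW ly)).
    have : 4 * K * (1 - enorm y) < eps.
      by rewrite mulrC -ltr_pdivlMr //; lra.
    have := enorm_ge0 y; rewrite /refl_diff; nra.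
  + move=> y /= [yr]; rewrite dotC le_eqVlt => /orP[/eqP ly|ly] wy.
      by move: wy; rewrite /refl_diff refl_fix // subrr ltxx.
    by split => //; exact: le_lt_trans r'1.
move=> x t /= [x1 lx] t0 wx.
have psix : 0 < psi x by apply: lt_le_trans e0 _; apply: psi_ge => //; exact: ltW.
have [p [H [J T]]] := refl_diff_jet ee (ltW l0) (ltW lx) x1.
have [q [M [JM TM]]] := Jpsi x.
exists p, H, q, M; split => //; rewrite T TM.
have tpsi := mulr_gt0 t0 psix.
have vlt : v x < v (refl e l x) by rewrite /refl_diff in wx; lra.
(* Near the sphere the Laplacian of the difference is at most 0; on the core the difference is
   nonnegative by hypothesis; in the slab its Laplacian is at most C t psi < t. In each case -t from
   psi decides. *)
have [xr0|xr0] := ltP r0 (enorm x).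
  have := h_mono (ltW (vs0 _ xr0 x1)) (ltW vlt); lra.
have [lex|xle] := leP (l + 2 * eta) (dot x e).
  have := wK _ xr0 lex; lra.
have := osl _ _ (ltW (v_gt0 x1)) (ltW vlt).
have -> : v (refl e l x) - v x = t * psi x by rewrite /refl_diff in wx; lra.
have psi6 : psi x <= 6 * eta.
  rewrite /psi; rewrite dotC in lx xle.
  have := sqr_ge0 (dot e x + (eta - l)); lra.
have : C * (t * psi x) <= t * (C * (6 * eta)).
  by rewrite mulrCA ler_pM2l // ler_wpM2l.
have : t * (C * (6 * eta)) < t * 1 by rewrite ltr_pM2l.
lra.
Qed.

Lemma refl_continuous e l x : dot e e = 1 -> forall k y,
  enorm (refl e (l + k) (x + y) - refl e l x) <= enorm y + 2 * `|k|.
Proof.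
move=> ee k y; have e1 : enorm e = 1 by rewrite enormE ee sqrtr1.
rewrite /refl mulmxDl mulrDr scalerDl addrACA [X in X - _]addrC addrK.
apply: le_trans (enormD _ _) _; rewrite orth_enorm ?refl_mx_orth //.
by rewrite enormZ e1 mulr1 normrM ger0_norm.
Qed.

(** Joint in the hyperplane and the point, because the covering argument of [moving_planes] perturbs
    both. *)
Lemma refl_diff_cont e l x : dot e e = 1 -> enorm x < 1 -> enorm (refl e l x) < 1 ->
  forall eps : R, 0 < eps -> exists2 d, 0 < d & forall k y, `|k| < d -> enorm y < d ->
    `|refl_diff e (l + k) (x + y) - refl_diff e l x| < eps.
Proof.
move=> ee x1 rx1 eps eps0; have eps2 : 0 < eps / 2 by rewrite divr_gt0.
have /continuous_atP/(_ _ eps2)[d1 d10 D1] := v_cont x1.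
have /continuous_atP/(_ _ eps2)[d2 d20 D2] := v_cont rx1.
exists (Num.min d1 (d2 / 3)); first by rewrite lt_min d10 divr_gt0.
move=> k y; rewrite !lt_min => /andP[_ kd] /andP[yd1 yd2].
have := D2 (refl e (l + k) (x + y) - refl e l x); rewrite subrKC.
have A : enorm (refl e (l + k) (x + y) - refl e l x) < d2.
  apply: le_lt_trans (refl_continuous l x ee k y) _; lra.
move=> /(_ A); have := D1 _ yd1; rewrite /refl_diff !ltr_norml.
by move=> /andP[? ?] /andP[? ?]; apply/andP; split; lra.
Qed.

Lemma refl_diff_ge0_limit e l l' x : dot e e = 1 -> enorm x < 1 ->
  enorm (refl e l x) < 1 -> l < l' ->
  (forall t, l < t < l' -> 0 <= refl_diff e t x) -> 0 <= refl_diff e l x.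
Proof.
move=> ee x1 rx1 ll' H; rewrite leNgt; apply/negP => wx.
have wx' : 0 < - refl_diff e l x by rewrite oppr_gt0.
have [d d0 dP] := refl_diff_cont ee x1 rx1 wx'.
pose k := Num.min d (l' - l) / 2.
have m0 : 0 < Num.min d (l' - l) by rewrite lt_min d0 subr_gt0.
have [md ml] : Num.min d (l' - l) <= d /\ Num.min d (l' - l) <= l' - l.
  by rewrite !ge_min !lexx orbT.
have := dP k 0; rewrite enorm0 addr0 gtr0_norm ?divr_gt0 //.
have -> : k < d by rewrite /k; lra.
have : 0 <= refl_diff e (l + k) x by apply: H; rewrite /k; apply/andP; split; lra.
move=> w0 /(_ isT d0); rewrite ltr_norml => /andP[_]; lra.
Qed.

(** The supremum [s] of the failing positions would itself be good, with strict inequality inside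
    its cap. Compactness then keeps nearby positions good on a core, and [offK] extends this to
    whole caps, against the choice of [s]. *)
Lemma moving_planes e l x : dot e e = 1 -> 0 < l < 1 ->
  enorm x < 1 -> l < dot x e -> 0 <= refl_diff e l x.
Proof.
move=> ee; have [r0 [eta0 [/andP[r00 r01] eta00 offK]]] := refl_diff_ge0_off_compact.
have e1 : enorm e = 1 by rewrite enormE ee sqrtr1.
pose bad : set R := [set l | 0 < l < 1 /\
  exists x, [/\ enorm x < 1, l < dot x e & refl_diff e l x < 0]].
suff nobad t : ~ bad t.
  move=> l01 x1 lx; rewrite leNgt; apply/negP => wx.
  by apply: (nobad l); split => //; exists x.
have bad_lt s : bad s -> s < r0.
  move=> [/andP[s0' s1] [y [y1 sy wy]]]; rewrite ltNge; apply/negP => rs.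
  suff : 0 <= refl_diff e s y by rewrite leNgt wy.
  apply: (offK e s eta0) => //; first by rewrite eta00 lexx.
  move=> z zr0 sz; have := dot_le z e; rewrite e1 mulr1; lra.
move=> badt; have bub : has_ubound bad by exists r0 => s /bad_lt/ltW.
have bsup : has_sup bad by split => //; exists t.
pose s := sup bad.
have s0' : 0 < s.
  have /andP[t0 _] := badt.1; apply: lt_le_trans t0 _; exact: ub_le_sup.
have s1 : s < 1.
  apply: le_lt_trans r01; apply: ge_sup; first by exists t.
  by move=> u /bad_lt/ltW.
have good u y : s < u < 1 -> enorm y < 1 -> u < dot y e -> 0 <= refl_diff e u y.
  move=> /andP[su u1] y1 uy; rewrite leNgt; apply/negP => wy.
  have : bad u by split; [rewrite u1 (lt_trans s0')|exists y].
  by move=> /(ub_le_sup bub); rewrite leNgt su.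
have ws y : enorm y < 1 -> s < dot y e -> 0 <= refl_diff e s y.
  move=> y1 sy; apply: (@refl_diff_ge0_limit e s (dot y e)) => //.
    by apply: refl_in_ball => //; exact: ltW.
  move=> u /andP[su uy]; apply: good => //; rewrite su; apply: lt_trans uy _.
  by apply: le_lt_trans (dot_le _ _) _; rewrite e1 mulr1.
have wsp := refl_diff_gt0 ee (introT andP (conj s0' s1)) ws.
pose eta := Num.min eta0 (s / 4).
have [et0 et1 et2] : [/\ 0 < eta, eta <= eta0 & eta <= s / 4].
  by rewrite /eta lt_min !ge_min !lexx orbT eta00 divr_gt0.
have [d d0 dP] : exists2 d, 0 < d & forall k y, `|k| < d -> enorm y <= r0 ->
    s + eta <= dot y e -> 0 <= refl_diff e (s + k) y.
  have cK := @compact_cap _ N r0 (s + eta) e.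
  have := (compact_near_coveringP _).1 cK _ (nbhs (0 : R))
    (fun k y => 0 <= refl_diff e (s + k) y) _.
  case.
    move=> y /= [yr sy]; rewrite dotC in sy.
    have y1 : enorm y < 1 by lra.
    have sy' : s < dot y e by lra.
    have wy := wsp _ y1 sy'.
    have [d d0 D] := refl_diff_cont ee y1 (refl_in_ball ee (ltW s0') (ltW sy') y1) wy.
    exists ([set z | enorm (z - y) < d], [set k | `|k| < d]).
      split => /=.
        by apply/near_enorm; exists d => // k; rewrite /= addrAC subrr add0r.
      by apply/nbhs_normP; exists d => // k; rewrite /= sub0r normrN.
    move=> [z k] /= [zd kd]; have := D _ _ kd zd; rewrite subrKC ltr_norml => /andP[+ _].
    lra.
  move=> d /= d0 dP; exists d => // k y kd yr sy.
  apply: (dP k); first by rewrite /= sub0r normrN.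
  by split => //; rewrite dotC.
have [u badu su] : exists2 u, bad u & s - Num.min d eta < u.
  by apply: sup_adherent => //; rewrite lt_min d0.
have us : u <= s by exact: ub_le_sup.
have [md me] : Num.min d eta <= d /\ Num.min d eta <= eta.
  by split; rewrite ge_min lexx ?orbT.
have [/andP[u0 u1] [y [y1 uy wy]]] := badu.
(* As u > s - eta, the core u + 2 eta <= z.e lies in the fixed compact set s + eta <= z.e, on which
   [d] is uniform. *)
suff : 0 <= refl_diff e u y by rewrite leNgt wy.
apply: (offK e u eta) => //; first by rewrite et0.
move=> z zr uz; rewrite -(subrKC s u); apply: dP => //; last lra.
rewrite ler0_norm; lra.
Qed.

Theorem large_solution_radial : (forall x y, enorm x < 1 -> enorm x = enorm y -> v x = v y) /\
  (forall e r s, enorm e = 1 -> 0 <= r -> r < s -> s < 1 -> v (r *: e) < v (s *: e)).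
Proof.
(* Distinct points of equal norm are mirror images in a hyperplane through the origin, that is l =
   0, which [moving_planes] reaches only in the limit. *)
have sym x y : enorm x < 1 -> enorm x = enorm y -> v y <= v x.
  move=> x1 xy; have [->//|nxy] := eqVneq x y.
  have n0 : 0 < enorm (x - y).
    rewrite lt_def enorm_ge0 andbT; apply: contra nxy => /eqP/enorm_eq0/eqP.
    by rewrite subr_eq0.
  pose e := (enorm (x - y))^-1 *: (x - y).
  have ee : dot e e = 1.
    by rewrite dotZl dotZr -enorm_sqr; field; rewrite gt_eqF.
  have D : dot (x - y) (x - y) = 2 * dot x (x - y).
    have : dot x x = dot y y by rewrite -!enorm_sqr xy.
    by rewrite !dotE (dotC y x); lra.
  have xe : 2 * dot x e = enorm (x - y).
    by rewrite dotZr mulrCA -D -enorm_sqr; field; rewrite gt_eqF.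
  have xe0 : 0 < dot x e by lra.
  have ry : refl e 0 x = y.
    by rewrite reflE subr0 xe /e scalerA divff ?gt_eqF // scale1r subKr.
  rewrite -subr_ge0 (_ : v x - v y = refl_diff e 0 x); last by rewrite /refl_diff ry.
  apply: (@refl_diff_ge0_limit e 0 (dot x e)) => //.
    by rewrite ry -xy.
  move=> t /andP[t0 tx]; apply: moving_planes => //; rewrite t0.
  apply: lt_trans tx _; apply: le_lt_trans (dot_le _ _) _.
  by rewrite (enormE e) ee sqrtr1 mulr1.
split=> [x y x1 xy|e r s e1 r0 rs s1].
  by apply/eqP; rewrite eq_le !sym // -?xy.
have ee : dot e e = 1 by rewrite -enorm_sqr e1 expr1n.
(* The hyperplane midway exchanges r e and s e, and [refl_diff_gt0] makes the inequality strict. *)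
pose l := (r + s) / 2.
have l01 : 0 < l < 1 by rewrite /l; lra.
have -> : r *: e = refl e l (s *: e).
  by rewrite reflE dotZl ee -scalerBl; congr (_ *: _); rewrite /l; field.
rewrite -subr_gt0; apply: (@refl_diff_gt0 e l) => //.
- by move=> x x1 lx; exact: moving_planes.
- by rewrite enormZ e1 mulr1 ger0_norm //; lra.
- by rewrite dotZl ee mulr1 /l; lra.
Qed.

End LargeSolution.

(** * Expansions of functions of class C2 *)

Section C2Jets.
Variables (R : realType) (N : nat).
Implicit Types (x y w : 'rV[R]_N) (g u : 'rV[R]_N -> R).

Lemma is_derive_line g z w (t d : R) :
  is_derive (z + t *: w) w g d <-> is_derive t 1 (fun s : R => g (z + s *: w)) d.
Proof.
have E k : k *: w + (z + t *: w) = z + (t + k) *: w.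
  by rewrite scalerDl addrCA (addrC (t *: w)).
split=> [H|H].
  apply/is_derive1_normP => e e0.
  have [r r0 rP] := (is_derive_normP _ _ _ _).1 H _ e0.
  by exists r => // k /rP; rewrite E.
apply/is_derive_normP => e e0.
have [r r0 rP] := (is_derive1_normP _ _ _).1 H _ e0.
by exists r => // k /rP; rewrite E.
Qed.

Lemma uniform_radius (P : 'I_N -> 'rV[R]_N -> Prop) :
  (forall i, exists2 d : R, 0 < d & forall k, enorm k < d -> P i k) ->
  exists2 d : R, 0 < d & forall k, enorm k < d -> forall i, P i k.
Proof.
move=> H.
have : \forall k \near (0 : 'rV[R]_N), forall i, P i k.
  apply: (@filter_forall _ _ P _ (nbhs_filter (0 : 'rV[R]_N))) => i; apply/near_enorm.
  by have [d d0 dP] := H i; exists d => // k /dP; rewrite add0r.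
by move=> /near_enorm[d d0 dP]; exists d => // k /dP; rewrite add0r.
Qed.

Definition C1_on_ball g := forall i, forall x, enorm x < 1 ->
  derivable g x (delta_mx 0 i) /\ {for x, continuous (partial i g)}.

Lemma enorm_delta i : enorm (delta_mx 0 i : 'rV[R]_N) = 1.
Proof.
rewrite enormE /dot (bigD1 i) //= !mxE !eqxx mulr1 big1 ?addr0 ?sqrtr1 // => j ji.
by rewrite !mxE (negbTE ji) mulr0.
Qed.

(* Continuous partial derivatives imply differentiability: move from x to x + k
   one coordinate at a time. *)
Lemma C1_jet1 g x : C1_on_ball g -> enorm x < 1 ->
  forall e : R, 0 < e -> exists2 d, 0 < d & forall k, enorm k < d ->
    `|g (x + k) - g x - dot (grad g x) k| <= e * enorm k.
Proof.
move=> C1 x1 e e0; have e1 : 0 < e / (N%:R + 1).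
  by rewrite divr_gt0 // ltr_wpDl.
have [d d0 dP] : exists2 d, 0 < d & forall k, enorm k < d -> forall i,
    `|partial i g (x + k) - partial i g x| < e / (N%:R + 1).
  apply: uniform_radius => i; have [_ /continuous_atP] := C1 i _ x1; exact.
pose d' := Num.min d (1 - enorm x) / 2.
have d'0 : 0 < d' by rewrite divr_gt0 // lt_min d0 subr_gt0.
have [dd dx] : 2 * d' <= d /\ 2 * d' <= 1 - enorm x.
  by rewrite /d' mulrC divfK // !ge_min !lexx orbT.
exists d' => // k kd.
pose trk n : 'rV[R]_N := \row_j (if (j < n)%N then k 0 j else 0).
have trk_le n : enorm (trk n) <= enorm k.
  rewrite -ler_sqr ?nnegrE ?enorm_ge0 // !enorm_sqr; apply: ler_sum => j _.
  by rewrite mxE; case: ifP; rewrite // mulr0 -expr2 sqr_ge0.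
have trkS (i : 'I_N) : trk i.+1 = trk i + k 0 i *: delta_mx 0 i.
  apply/rowP => j; rewrite !mxE eqxx /= ltnS leq_eqVlt.
  have [->|ji] := eqVneq j i; first by rewrite eqxx ltnn /= mulr1 add0r.
  by rewrite (negbTE (_ : (j != i :> nat))) //= mulr0 addr0.
have tel : g (x + k) - g x - dot (grad g x) k =
    \sum_(i < N) (g (x + trk i.+1) - g (x + trk i) - partial i g x * k 0 i).
  rewrite big_split /= -(big_mkord xpredT (fun i => g (x + trk i.+1) - g (x + trk i))).
  rewrite telescope_sumr // sumrN; congr (_ - _ - _).
  - by congr (g (x + _)); apply/rowP => j; rewrite mxE ltn_ord.
  - by congr g; rewrite -[LHS]addr0; congr (_ + _); apply/rowP => j; rewrite !mxE.
  - by apply: eq_bigr => i _; rewrite mxE.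
rewrite tel; apply: le_trans (ler_norm_sum _ _ _) _.
apply: (@le_trans _ _ (\sum_(i < N) e / (N%:R + 1) * enorm k)); last first.
  rewrite sumr_const card_ord -[leLHS]mulr_natl mulrA ler_wpM2r ?enorm_ge0 //.
  rewrite mulrCA ger_pMr // ler_pdivrMr; last by rewrite ltr_wpDl.
  by rewrite mul1r lerDl.
apply: ler_sum => i _.
pose dphi t := partial i g (x + trk i + t *: delta_mx 0 i) - partial i g x.
pose phi t := g (x + trk i + t *: delta_mx 0 i) - partial i g x * t.
have small t : `|t| <= `|k 0 i| -> enorm (trk i + t *: delta_mx 0 i) < 2 * d'.
  move=> tk; apply: le_lt_trans (enormD _ _) _; rewrite enormZ enorm_delta mulr1.
  have := trk_le i; have := coord_le_enorm k i; lra.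
have Dphi (t : R) : `|t| <= `|k 0 i| -> is_derive t 1 phi (dphi t).
  move=> tk; have inb : enorm (x + trk i + t *: delta_mx 0 i) < 1.
    rewrite -addrA; apply: le_lt_trans (enormD _ _) _; have := small _ tk; lra.
  have [dg _] := C1 i _ inb.
  have D1 := (is_derive_line _ _ _ _ _).1 (derivableP dg).
  by apply: is_derive_eq; rewrite /GRing.scale /= mulr1.
have -> : g (x + trk i.+1) - g (x + trk i) - partial i g x * k 0 i =
    phi (0 + k 0 i) - phi 0.
  rewrite /phi add0r scale0r addr0 mulr0 subr0 trkS addrA; ring.
have D0 (t : R) : `|t| <= `|k 0 i| -> is_derive (0 + t) 1 phi (dphi (0 + t)).
  by rewrite add0r; exact: Dphi.
have B0 (t : R) : `|t| <= `|k 0 i| -> `|dphi (0 + t)| <= e / (N%:R + 1).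
  move=> tk; rewrite add0r /dphi -addrA; apply/ltW/dP.
  exact: lt_le_trans (small _ tk) dd.
apply: le_trans (mvt_le_norm D0 B0) _.
by rewrite ler_wpM2l ?coord_le_enorm // ltW.
Qed.

Lemma C1_line g z w (t : R) : C1_on_ball g -> enorm (z + t *: w) < 1 ->
  is_derive t 1 (fun s : R => g (z + s *: w)) (dot (grad g (z + t *: w)) w).
Proof.
move=> C1 z1; apply/is_derive1_normP => e e0.
have w0 : 0 < enorm w + 1 by rewrite ltr_wpDl // enorm_ge0.
have [d d0 dP] := C1_jet1 C1 z1 (divr_gt0 e0 w0).
exists (d / (enorm w + 1)); first exact: divr_gt0.
move=> k; rewrite ltr_pdivlMr // => kd.
have kw : enorm (k *: w) <= `|k| * (enorm w + 1).
  by rewrite enormZ ler_wpM2l // lerDl.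
have := dP (k *: w) (le_lt_trans kw kd).
rewrite dotZr scalerDl addrA (mulrC k) => A; apply: le_trans A _.
rewrite -mulrA ler_pM2l // mulrC ler_pdivrMr //.
Qed.

Definition hess u x : 'M[R]_N := \matrix_(i, j) partial i (partial j u) x.

(** Along the segment from x to x + k, the derivative of the Taylor error is the sum over j of the
    first-order error of the j-th partial derivative times k_j. *)
Lemma C2_jet2 u x : C1_on_ball u -> (forall j, C1_on_ball (partial j u)) ->
  enorm x < 1 -> jet2 u x (grad u x) (hess u x).
Proof.
move=> C1 C2 x1 e e0; have e1 : 0 < e / (N%:R + 1).
  by rewrite divr_gt0 // ltr_wpDl.
have [d d0 dP] : exists2 d, 0 < d & forall k, enorm k < d -> forall j,
    `|partial j u (x + k) - partial j u x - dot (grad (partial j u) x) k|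
       <= e / (N%:R + 1) * enorm k.
  by apply: uniform_radius => j; exact: C1_jet1.
exists (Num.min d (1 - enorm x)); first by rewrite lt_min d0 subr_gt0.
move=> k; rewrite lt_min => /andP[kd kx].
pose phi t := u (x + t *: k) - dot (grad u x) k * t - dot (k *m hess u x) k / 2 * t ^+ 2.
have tk t : 0 <= t <= 1 -> enorm (t *: k) <= t * enorm k /\ t * enorm k <= enorm k.
  move=> /andP[t0 t1]; rewrite enormZ ger0_norm //; split => //.
  by rewrite ler_piMl // enorm_ge0.
have Dphi (t : R) : 0 <= t <= 1 -> is_derive t 1 phi
    (dot (grad u (x + t *: k)) k - dot (grad u x) k - dot (k *m hess u x) k * t).
  move=> /tk[tk1 tk2]; have inb : enorm (x + t *: k) < 1.
    apply: le_lt_trans (enormD _ _) _; lra.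
  have D1 := C1_line C1 inb.
  by apply: is_derive_eq; rewrite /GRing.scale /=; field.
have -> : u (x + k) - u x - dot (grad u x) k - dot (k *m hess u x) k / 2 = phi 1 - phi 0.
  rewrite /phi scale1r scale0r addr0; ring.
have := @mvt_le _ phi _ 0 1 (e * enorm k ^+ 2) ler01 Dphi.
rewrite subr0 mulr1; apply=> t t01; have [tk1 tk2] := tk _ t01.
have td : enorm (t *: k) < d by apply: le_lt_trans tk1 _; exact: le_lt_trans kd.
have -> : dot (grad u (x + t *: k)) k - dot (grad u x) k - dot (k *m hess u x) k * t =
    \sum_(j < N) (partial j u (x + t *: k) - partial j u x -
      dot (grad (partial j u) x) (t *: k)) * k 0 j.
  have -> : dot (k *m hess u x) k * t = \sum_j dot (grad (partial j u) x) (t *: k) * k 0 j.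
    rewrite mulr_suml; apply: eq_bigr => j _.
    rewrite dotZr mulrAC (mulrC _ t); congr (_ * _ * _).
    by rewrite mxE; apply: eq_bigr => i _; rewrite !mxE mulrC.
  rewrite /dot -!sumrB; apply: eq_bigr => j _; rewrite !mxE; ring.
apply: le_trans (ler_norm_sum _ _ _) _.
apply: (@le_trans _ _ (\sum_(j < N) e / (N%:R + 1) * enorm k ^+ 2)).
  apply: ler_sum => j _; rewrite normrM expr2 mulrA; apply: ler_pM => //.
    apply: le_trans (dP _ td j) _; rewrite ler_pM2l //; exact: le_trans tk1 _.
  exact: coord_le_enorm.
rewrite sumr_const card_ord -[leLHS]mulr_natl mulrA ler_wpM2r ?sqr_ge0 //.
rewrite mulrCA ger_pMr // ler_pdivrMr; last by rewrite ltr_wpDl.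
by rewrite mul1r lerDl.
Qed.

Lemma class_C2_jet2 u : class_C 2 (@unit_ball R N) u -> forall x, enorm x < 1 ->
  jet2 u x (grad u x) (hess u x).
Proof.
move=> /= [_ U] x x1; apply: C2_jet2 => // [i y y1|j i y y1].
  by have [D [C _]] := U i; split; [exact: D|exact: C].
have [_ [_ V]] := U j; have [D [C _]] := V i.
by split; [exact: D|exact: C].
Qed.

Lemma divergence_aDu (a : R -> R) u x : (forall s, derivable a s 1) ->
  class_C 2 (@unit_ball R N) u -> enorm x < 1 ->
  divergence (fun y => a (u y) *: grad u y) x =
    derive1 a (u x) * enorm (grad u x) ^+ 2 + a (u x) * \tr (hess u x).
Proof.
move=> Da /= [_ U] x1.
rewrite enorm_sqr /dot /mxtrace /divergence !mulr_sumr -big_split /=.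
apply: eq_bigr => i _; rewrite !mxE /partial.
have [D1 [_ V]] := U i; have [D2 _] := V i.
have du := derivableP (D1 _ x1); have ddu := derivableP (D2 _ x1).
have dau : is_derive x (delta_mx 0 i : 'rV[R]_N) (fun y => a (u y))
    (derive1 a (u x) * partial i u x).
  have Ex : x = x + (0 : R) *: delta_mx 0 i by rewrite scale0r addr0.
  rewrite [X in is_derive X]Ex; apply/is_derive_line.
  have du' : is_derive (0 : R) 1 (fun s : R => u (x + s *: delta_mx 0 i)) (partial i u x).
    by apply/is_derive_line; rewrite -Ex.
  have da : is_derive (u (x + (0 : R) *: delta_mx 0 i)) 1 a (derive1 a (u x)).
    by rewrite -Ex derive1E; exact/derivableP.
  exact: (is_derive1_comp da du').
have -> : (fun y => (a (u y) *: grad u y) 0 i) = (fun y => a (u y)) * partial i u.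
  by apply/funext => y; rewrite !mxE.
have [_ ->] := is_deriveM dau ddu.
rewrite /GRing.scale /= /partial; ring.
Qed.

End C2Jets.

(** * Reduction to the semilinear equation *)

Section OneVariable.
Variable R : realType.
Implicit Types (g dg F dF : R -> R) (r s t d : R).

Lemma is_derive_continuous g s d : is_derive s 1 g d -> {for s, continuous g}.
Proof. by move=> [D _]; apply: differentiable_continuous; exact/derivable1_diffP. Qed.

Lemma mvt_ge F dF r s d : r <= s ->
  (forall t, r <= t <= s -> is_derive t 1 F (dF t)) ->
  (forall t, r <= t <= s -> d <= dF t) -> d * (s - r) <= F s - F r.
Proof.
move=> rs FD dFd.
have FD' t : t \in `]r, s[%R -> is_derive t 1 F (dF t).
  by rewrite in_itv /= => /andP[rt ts]; apply: FD; rewrite !ltW.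
have Fc : {within `[r, s], continuous F}.
  apply: derivable_within_continuous => t; rewrite in_itv /= => rts.
  by have [] := FD _ rts.
have [c crs ->] := MVT_segment rs FD' Fc.
by rewrite ler_wpM2r ?subr_ge0 // dFd //; move: crs; rewrite in_itv.
Qed.

Lemma bounded_segment g r s : (forall t, {for t, continuous g}) ->
  exists2 C, 0 <= C & forall t, r <= t <= s -> `|g t| <= C.
Proof.
move=> gc; have [rs|sr] := leP r s; last first.
  exists 0 => // t /andP[rt ts]; have := le_trans rt ts; lra.
have [|c crs cP] := @EVT_max _ (fun t => `|g t|) _ _ rs.
  apply: continuous_in_subspaceT => t _.
  by apply: (@continuous_comp _ _ _ g Num.norm); [exact: gc|exact: norm_continuous].
by exists `|g c| => // t rts; apply: cP; rewrite in_itv.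
Qed.

(** The integral starts at b - 1, so that G has a two-sided derivative at [b] too. *)
Lemma exists_primitive g b : (forall t, {for t, continuous g}) ->
  exists2 G, G b = 0 & forall s, b - 1 < s -> is_derive s 1 G (g s).
Proof.
move=> gc.
pose F x : R := \int[lebesgue_measure]_(t in [set` Interval (BLeft (b - 1)) (BRight x)]) g t.
exists (fun x => F x - F b); first by rewrite subrr.
move=> s bs.
have ci : lebesgue_measure.-integrable [set` Interval (BLeft (b - 1)) (BRight (s + 1))] (EFin \o g).
  apply: continuous_compact_integrable; first exact: segment_compact.
  by apply: continuous_in_subspaceT => t _; exact: gc.
have ss1 : s < s + 1 by rewrite ltrDl.
have [D E] := continuous_FTC1_closed ss1 ci bs (gc s).
have FD : is_derive s 1 F (g s) by apply: DeriveDef => //; rewrite -derive1E.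
by apply: is_derive_eq; rewrite subr0.
Qed.

Lemma is_derive_ln g s d : 0 < g s -> is_derive s 1 g d ->
  is_derive s 1 (fun t => ln (g t)) (d / g s).
Proof.
move=> gs gd; rewrite mulrC.
exact: (is_derive1_comp (is_derive1_ln gs) gd).
Qed.

Lemma is_derive_sqrt g s d : 0 < g s -> is_derive s 1 g d ->
  is_derive s 1 (fun t => Num.sqrt (g t)) (d / (2 * Num.sqrt (g s))).
Proof.
move=> gs gd; rewrite mulrC.
exact: (is_derive1_comp (is_derive1_sqrt gs) gd).
Qed.

Lemma class_C2_derive g s : class_C2 g -> is_derive s 1 g (derive1 g s).
Proof. by move=> [D _ _]; rewrite derive1E; exact/derivableP. Qed.

Lemma class_C2_derive1 g s : class_C2 g -> is_derive s 1 (derive1 g) (derive1n 2 g s).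
Proof. by move=> [_ D _]; rewrite derive1nS derive1n1 derive1E; exact/derivableP. Qed.

End OneVariable.

(** * Consequences of blow-up at the sphere *)

Section Blowup.
Variables (R : realType) (N : nat).
Implicit Types (x y : 'rV[R]_N) (u : 'rV[R]_N -> R).

(** The competitor is the radial projection x / |x|, hence x must be nonzero. *)
Lemma dist_to_sphere_le x : 0 < enorm x -> enorm x < 1 ->
  dist_to (@unit_sphere R N) x <= 1 - enorm x.
Proof.
move=> x0 x1; apply: ge_inf.
  by exists 0 => _ [y _ <-]; exact: enorm_ge0.
exists ((enorm x)^-1 *: x).
  by rewrite /unit_sphere /= enormZ ger0_norm ?invr_ge0 ?ltW // mulVf // gt_eqF.
rewrite -{1}(scale1r x) -scalerBl enormZ ler0_norm.
  by rewrite opprB mulrBl mulVf ?gt_eqF // mul1r.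
by rewrite subr_le0 invf_ge1 // ltW.
Qed.

Lemma blowup_enorm u : blows_up_at_sphere u -> forall M, exists2 r, 0 <= r < 1 &
  forall x, r < enorm x -> enorm x < 1 -> M < u x.
Proof.
move=> bu M; have [d d0 dP] := bu M.
have r1 : Num.max 0 (1 - d) < 1 by rewrite gt_max ltr01 gtrBl.
exists (Num.max 0 (1 - d)); first by rewrite le_max lexx r1.
move=> x; rewrite gt_max => /andP[x0 xd] x1; apply: dP => //.
by apply: le_lt_trans (dist_to_sphere_le x0 x1) _; lra.
Qed.

(** Supplies the base point of the primitive G, below all values of u, so that v = G(u) is
    positive. *)
Lemma blowup_bounded_below u : (forall x, enorm x < 1 -> {for x, continuous u}) ->
  blows_up_at_sphere u -> exists b, forall x, enorm x < 1 -> b < u x.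
Proof.
move=> uc /blowup_enorm bu; have [r /andP[r0 r1] rP] := bu 0.
have [||z /= zr zm] := @compact_min _ _ u _ (@compact_ball _ N r).
- by exists 0; rewrite /= enorm0.
- by move=> x /= xr; apply: uc; exact: le_lt_trans r1.
exists (Num.min 0 (u z - 1)) => x x1; rewrite gt_min.
have [xr|xr] := leP (enorm x) r; apply/orP; [right|left].
  by have := zm _ xr; lra.
exact: rP.
Qed.

End Blowup.

(* A common form of the growth conditions: m(s) = s covers the polynomial and
   logarithmic a, m = 1 the exponential one. With theta = 2/(p + mu), they give
   theta m sqrt a <= G eventually, and delta = theta (p - kappa/2) - 1 > 0. *)
Theorem growth_radial (R : realType) (N : nat) (hN : (1 <= N)%N)
    (a f m dm : R -> R) (nu kappa mu p S : R) (u : 'rV[R]_N -> R) :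
  class_C2 a -> class_C2 f -> 0 < nu -> (forall s, nu <= a s) ->
  0 <= kappa -> 0 <= mu -> kappa + mu < p ->
  (forall s, S <= s -> [/\ 0 < m s, is_derive s 1 m (dm s) & dm s <= mu]) ->
  (forall s, S <= s ->
     [/\ 0 < f s, m s * derive1 a s <= kappa * a s & p * f s <= m s * derive1 f s]) ->
  solves_P a f u -> radial_increasing u.
Proof.
move=> aC fC nu0 a_ge kap0 mu0 kmp mP afP [uC ueq ublow].
have a0 s : 0 < a s by exact: lt_le_trans (a_ge s).
pose ga s := Num.sqrt (a s); pose c := Num.sqrt nu.
have c0 : 0 < c by rewrite sqrtr_gt0.
have gac s : c <= ga s by rewrite ler_wsqrtr.
have ga0 s : 0 < ga s by exact: lt_le_trans (gac s).
have ga2 s : a s = ga s ^+ 2 by rewrite sqr_sqrtr // ltW.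
have Da s := class_C2_derive s aC; have Df s := class_C2_derive s fC.
have Dga (s : R) : is_derive s 1 ga (derive1 a s / (2 * ga s)) := is_derive_sqrt (a0 s) (Da s).
have gacont (s : R) : {for s, continuous ga} := is_derive_continuous (Dga s).
have ujet x : enorm x < 1 -> jet2 u x (grad u x) (hess u x) := class_C2_jet2 uC (x:=x).
have [b ub] : exists b, forall x, enorm x < 1 -> b < u x.
  by apply: blowup_bounded_below => // x /ujet; exact: jet2_continuous.
have [G Gb DG] := exists_primitive b gacont.
have DGb (s : R) : b <= s -> is_derive s 1 G (ga s) by move=> bs; apply: DG; lra.
have Ginc s t : b <= s -> s <= t -> c * (t - s) <= G t - G s.
  move=> bs st; apply: (@mvt_ge _ G ga) => // r /andP[sr _].
  by apply: DGb; exact: le_trans sr.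
have Glt s t : b <= s -> s < t -> G s < G t.
  move=> bs st; have := Ginc _ _ bs (ltW st).
  have : 0 < c * (t - s) by rewrite mulr_gt0 // subr_gt0.
  lra.
have Gge0 s : b <= s -> 0 <= G s.
  move=> bs; have := Ginc _ _ (lexx b) bs; rewrite Gb subr0; apply: le_trans.
  by rewrite mulr_ge0 ?subr_ge0 // ltW.
have Gle s t : b <= s -> b <= t -> G s <= G t -> s <= t.
  by move=> bs bt; apply: contraTT; rewrite -!ltNge; exact: Glt.
(* [Gi] will invert G on [0, +oo) and is arbitrary elsewhere. G is onto because its slope is at
   least [c]. *)
have Gsurj y : exists t, 0 <= y -> b <= t /\ G t = y.
  have [y0|] := leP 0 y; last by exists b; lra.
  have yc : 0 <= y / c by rewrite divr_ge0 // ltW.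
  have byc : b <= b + y / c by rewrite lerDl.
  have yG : y <= G (b + y / c).
    have := Ginc _ _ (lexx b) byc; rewrite Gb subr0 addrAC subrr add0r mulrC divfK //.
    by rewrite gt_eqF.
  have Gc : {within `[b, b + y / c], continuous G}.
    apply: derivable_within_continuous => t; rewrite in_itv /= => /andP[bt _].
    by have [] := DGb _ bt.
  have [|t tb Gt] := IVT byc Gc (v := y).
    by rewrite Gb ge_min le_max y0 yG orbT.
  by exists t => _; move: tb; rewrite in_itv /= => /andP[].
have [Gi GiP] := choice Gsurj.
pose h y := f (Gi y) / ga (Gi y).
have hG t : b <= t -> h (G t) = f t / ga t.
  move=> bt; have [bg gG] := GiP _ (Gge0 _ bt).
  have gt : Gi (G t) = t.
    by apply/le_anti/andP; split; apply: Gle => //; rewrite gG.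
  by rewrite /h gt.
pose v x := G (u x).
have v_gt0 x : enorm x < 1 -> 0 < v x by move=> /ub bu; rewrite -Gb; exact: Glt.
have v_jet x : enorm x < 1 -> exists p H, jet2 v x p H /\ \tr H = h (v x).
  move=> x1; have bu := ub _ x1.
  have r0 : 0 < u x - (b - 1) by lra.
  have Dr (t : R) : `|t| < u x - (b - 1) -> is_derive (u x + t) 1 G (ga (u x + t)).
    by rewrite ltr_norml => /andP[t1 _]; apply: DG; lra.
  have J := jet2_comp (ujet _ x1) (taylor2 r0 Dr (Dga (u x))).
  eexists; eexists; split; first exact: J.
  rewrite mxtraceD !mxtraceZ mxtrace_tr_mul hG; last exact: ltW.
  have Dad s : derivable a s 1 by case: aC.
  (* Expanded, the equation reads a Lap u + (a'/2)|Du|^2 = f; divided by sqrt a, its left side is G'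
     Lap u + G'' |Du|^2 = Lap v. *)
  have := ueq x x1; rewrite (divergence_aDu Dad uC x1).
  rewrite ga2; have g0 := ga0 (u x); set g := ga (u x) in g0 *.
  set P := enorm _ ^+ 2; set T := \tr _; set A := derive1 a (u x); move=> E.
  have -> : f (u x) = A * P + g ^+ 2 * T - A / 2 * P by lra.
  field; exact: lt0r_neq0.
have v_blowup M : exists2 r, 0 <= r < 1 &
    forall x, r < enorm x -> enorm x < 1 -> M < v x.
  have [r r01 rP] := blowup_enorm ublow (Gi (Num.max M 0)).
  exists r => // x rx x1; have := rP _ rx x1.
  have [bg gG] := GiP (Num.max M 0) (ltac:(by rewrite le_max lexx orbT)).
  move=> /(Glt _ _ bg); rewrite gG; apply: le_lt_trans; by rewrite le_max lexx.
have h_lip M : exists2 C, 0 <= C &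
    forall r s, 0 <= r -> r <= s -> s <= M -> `|h s - h r| <= C * (s - r).
  have M0 : 0 <= Num.max M 0 by rewrite le_max lexx orbT.
  have [bM gM] := GiP _ M0.
  pose dH s := (derive1 f s * ga s - f s * (derive1 a s / (2 * ga s))) / ga s ^+ 2.
  have DH (s : R) : is_derive s 1 (fun t => f t / ga t) (dH s).
    have gn : ga s != 0 by rewrite gt_eqF.
    have Dgi := is_deriveV gn (Dga s).
    apply: is_derive_eq; rewrite /GRing.scale /= /dH; field; exact: gn.
  have dHc (s : R) : {for s, continuous dH}.
    have c1 : {for s, continuous (derive1 f)} := is_derive_continuous (class_C2_derive1 s fC).
    have c2 : {for s, continuous (derive1 a)} := is_derive_continuous (class_C2_derive1 s aC).
    have c3 : {for s, continuous f} := is_derive_continuous (Df s).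
    have c4 : {for s, continuous (fun t => (2 * ga t)^-1)}.
      apply: continuousV; first by rewrite mulf_neq0 // gt_eqF.
      by apply: continuousM; [exact: cst_continuous|exact: gacont].
    have c5 : {for s, continuous (fun t => (ga t ^+ 2)^-1)}.
      apply: continuousV; first by rewrite expf_neq0 // gt_eqF.
      by apply: continuousM; exact: gacont.
    apply: (continuousM (s := fun s => derive1 f s * ga s - f s * (derive1 a s / (2 * ga s)))) c5.
    apply: (continuousB (f := fun s => derive1 f s * ga s)).
      exact: continuousM.
    by apply: continuousM => //; exact: continuousM.
  have [C C0 CP] := bounded_segment b (Gi (Num.max M 0)) dHc.
  (* [Gi] has Lipschitz constant 1/c because G' >= c. *)
  exists (C / c); first by rewrite divr_ge0 // ltW.
  move=> r s r0 rs sM; have s0 : 0 <= s by exact: le_trans rs.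
  have [br gr] := GiP _ r0; have [bs gs] := GiP _ s0.
  have rs' : Gi r <= Gi s by apply: Gle; rewrite // gr gs.
  have sM' : Gi s <= Gi (Num.max M 0).
    by apply: Gle; rewrite // gs gM le_max sM.
  have B : `|h s - h r| <= C * (Gi s - Gi r).
    rewrite /h; apply: (@mvt_le _ (fun t => f t / ga t) dH) => // t /andP[rt ts].
    by apply: CP; rewrite (le_trans br rt) (le_trans ts sM').
  apply: le_trans B _; rewrite -mulrA ler_wpM2l // ler_pdivlMl //.
  by have := Ginc _ _ br rs'; rewrite gr gs.
(* The reciprocal of the mean of mu + kappa/2 and p - kappa/2: theta times the first is below 1,
   theta times the second above 1, with equal gaps (p - mu - kappa)/(p + mu). *)
pose th := 2 / (p + mu).
have pm : 0 < p + mu by lra.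
have th0 : 0 < th by rewrite divr_gt0.
have th1 : 0 < 1 - th * (mu + kappa / 2).
  have -> : 1 - th * (mu + kappa / 2) = (p - mu - kappa) / (p + mu).
    by rewrite /th; field; rewrite gt_eqF.
  by rewrite divr_gt0 //; lra.
pose delta := th * (p - kappa / 2) - 1.
have delta0 : 0 < delta.
  have -> : delta = (p - mu - kappa) / (p + mu).
    by rewrite /delta /th; field; rewrite gt_eqF.
  by rewrite divr_gt0 //; lra.
have ga'_le s : S <= s -> m s * (derive1 a s / (2 * ga s)) <= kappa / 2 * ga s.
  move=> /afP[_ ma _]; rewrite mulrA ler_pdivrMr; last by rewrite mulr_gt0.
  by apply: le_trans ma _; rewrite ga2; lra.
(* G - theta m sqrt a has derivative at least e > 0, so its linear growth outweighs the initial
   value; the extra 1 gives b < S1. *)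
have [S1 S1P] : exists2 S1, S <= S1 /\ b < S1 &
    forall s, S1 <= s -> th * (m s * ga s) <= G s.
  pose S2 := Num.max S b; pose phi s := G s - th * (m s * ga s).
  have [SS2 bS2] : S <= S2 /\ b <= S2 by rewrite /S2 !le_max !lexx orbT.
  pose e := c * (1 - th * (mu + kappa / 2)); have e0 : 0 < e by rewrite mulr_gt0.
  have phi_ge s : S2 <= s -> e * (s - S2) <= phi s - phi S2.
    move=> s2; apply: (@mvt_ge _ phi (fun t => ga t -
       th * (m t * (derive1 a t / (2 * ga t)) + ga t * dm t))) => // t /andP[t1 _].
      have [_ Dm _] := mP _ (le_trans SS2 t1).
      have Gt := DGb _ (le_trans bS2 t1).
      by apply: is_derive_eq; rewrite /GRing.scale.
    have [_ _ dmt] := mP _ (le_trans SS2 t1).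
    have g1 := ga'_le _ (le_trans SS2 t1).
    have g2 : ga t * dm t <= ga t * mu by rewrite ler_pM2l.
    have g3 : th * (m t * (derive1 a t / (2 * ga t)) + ga t * dm t) <=
              th * (kappa / 2 * ga t + ga t * mu) by rewrite ler_pM2l // lerD.
    have g4 : e <= ga t * (1 - th * (mu + kappa / 2)) by rewrite ler_pM2r.
    lra.
  exists (S2 + `|phi S2| / e + 1).
    have : 0 <= `|phi S2| / e by rewrite divr_ge0 // ltW.
    by split; lra.
  move=> s sS; have p0 : 0 <= `|phi S2| / e by rewrite divr_ge0 // ltW.
  have sS2 : S2 <= s by lra.
  rewrite -subr_ge0 -/(phi s); have := phi_ge _ sS2.
  have : e * (`|phi S2| / e) <= e * (s - S2) by rewrite ler_pM2l //; lra.
  rewrite mulrC divfK ?gt_eqF //; have := ler_norm (- phi S2); rewrite normrN; lra.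
have [SS1 bS1] := S1P.
move=> GS.
(* The logarithm of h(y) / y^(1+delta) at y = G(s); its monotonicity is [h_pow]. *)
pose K s := ln (f s) - ln (a s) / 2 - (1 + delta) * ln (G s).
have G_gt0 s : S1 <= s -> 0 < G s.
  by move=> ss; rewrite -Gb; apply: Glt => //; exact: lt_le_trans ss.
have K_mono s t : S1 <= s -> s <= t -> K s <= K t.
  move=> ss st; rewrite -subr_ge0 -[leLHS](mul0r (t - s)).
  apply: (@mvt_ge _ K (fun r => derive1 f r / f r - derive1 a r / a r / 2 -
     (1 + delta) * (ga r / G r))) => // r /andP[sr _].
    have S1r := le_trans ss sr; have [f0 _ _] := afP _ (le_trans SS1 S1r).
    have D1 := is_derive_ln f0 (Df r); have D2 := is_derive_ln (a0 r) (Da r).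
    have D3 := is_derive_ln (G_gt0 _ S1r) (DGb _ (le_trans (ltW bS1) S1r)).
    by apply: is_derive_eq; rewrite /GRing.scale /=; ring.
  have S1r := le_trans ss sr; have [f0 ma mf] := afP _ (le_trans SS1 S1r).
  have [m0 _ _] := mP _ (le_trans SS1 S1r).
  have G0 := G_gt0 _ S1r; have g0 := ga0 r.
  rewrite -(pmulr_rge0 _ m0).
  have e1 : p <= m r * (derive1 f r / f r) by rewrite mulrA ler_pdivlMr.
  have e2 : m r * (derive1 a r / a r) <= kappa by rewrite mulrA ler_pdivrMr.
  (* Here theta m sqrt a <= G enters: m K' is at least p - kappa/2 - (1 + delta)/theta, which is
     0. *)
  have e3 : (1 + delta) * (m r * (ga r / G r)) <= p - kappa / 2.
    have -> : 1 + delta = th * (p - kappa / 2) by rewrite /delta; ring.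
    have pk : 0 <= p - kappa / 2 by lra.
    rewrite (mulrC th) -mulrA -[leRHS]mulr1 ler_wpM2l // !mulrA ler_pdivrMr // mul1r.
    by rewrite -mulrA; exact: GS.
  lra.
have h_gt0 s : G S1 <= s -> 0 < h s.
  move=> Gs; have s0 : 0 <= s by apply: le_trans Gs; apply/ltW/G_gt0.
  have [bs gs] := GiP _ s0.
  have S1s : S1 <= Gi s by apply: Gle; rewrite ?gs // ltW.
  by rewrite /h divr_gt0 //; have [] := afP _ (le_trans SS1 S1s).
have h_pow sigma s : 0 <= sigma -> G S1 <= s ->
    expR ((1 + delta) * sigma) * h s <= h (expR sigma * s).
  move=> si0 Gs; have s0 : 0 < s by apply: lt_le_trans Gs; exact: G_gt0.
  have [bs gs] := GiP _ (ltW s0).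
  have es0 : 0 < expR sigma * s by rewrite mulr_gt0 // expR_gt0.
  have [bt gt] := GiP _ (ltW es0).
  have S1s : S1 <= Gi s by apply: Gle; rewrite ?gs // ltW.
  have st : Gi s <= Gi (expR sigma * s).
    apply: Gle => //; rewrite gs gt; apply: ler_peMl; first exact: ltW.
    by rewrite -expR0 ler_expR.
  have S1t := le_trans S1s st.
  have := K_mono _ _ S1s st; rewrite /K gs gt lnM ?posrE ?expR_gt0 // expRK.
  have [fs _ _] := afP _ (le_trans SS1 S1s); have [ft _ _] := afP _ (le_trans SS1 S1t).
  have hE t : 0 < f t -> f t / ga t = expR (ln (f t) - ln (a t) / 2).
    move=> f0; rewrite expRD lnK ?posrE //; congr (_ * _).
    by rewrite expRN ga2 lnXn // -[ln (ga t) *+ 2]mulr_natr mulfK // lnK ?posrE.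
  move=> KK; rewrite /h !hE // -expRD ler_expR; lra.
have [vsym vinc] := large_solution_radial hN v_gt0 v_jet v_blowup
  (G_gt0 _ (lexx S1)) delta0 h_gt0 h_pow h_lip.
have uv x y : enorm x < 1 -> enorm y < 1 -> v x <= v y -> u x <= u y.
  by move=> /ub/ltW bx /ub/ltW byy; exact: Gle.
pose e : 'rV[R]_N := delta_mx 0 (Ordinal hN).
have e1 : enorm e = 1 by exact: enorm_delta.
have re r : 0 <= r -> enorm (r *: e) = r by move=> r0; rewrite enormZ e1 mulr1 ger0_norm.
exists (fun r => u (r *: e)).
  move=> x x1; have xe := re _ (enorm_ge0 x).
  have vv := vsym _ _ x1 (esym xe).
  by apply/eqP; rewrite eq_le !uv // ?xe // vv.
move=> r s r0 rs s1; have s0 : 0 <= s by lra.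
rewrite ltNge; apply/negP => us.
have := vinc _ _ _ e1 r0 rs s1; rewrite ltNge => /negP; apply.
rewrite /v; have bs : b < u (s *: e) by apply: ub; rewrite re.
move: us; rewrite le_eqVlt => /orP[/eqP ->//|us].
by apply/ltW/Glt => //; exact: ltW.
Qed.

(** * Asymptotic growth *)

Section Asymptotics.
Variable R : realType.
Implicit Types (phi psi dphi dpsi m : R -> R) (l p s : R).

Lemma near_pinftyP (P : set R) :
  (\forall s \near +oo, P s) <-> exists S, forall s, S <= s -> P s.
Proof.
split=> [[M [_ MP]]|[S SP]].
  by exists (M + 1) => s Ms; apply: MP; lra.
by exists S; split; [exact: num_real|move=> s /ltW; exact: SP].
Qed.

(** phi / psi tends to l, written without division so that it can be integrated. *)
Definition asym phi psi l := forall e : R, 0 < e ->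
  \forall s \near +oo, `|phi s - l * psi s| <= e * psi s.

Lemma cvg_asym phi psi l : (\forall s \near +oo, 0 < psi s) ->
  phi s / psi s @[s --> +oo] --> l -> asym phi psi l.
Proof.
move=> psi0 /cvgrPdistC_le c e e0; have := c _ e0; move: psi0.
apply: filterS2 => s ps; rewrite -(ler_pM2r ps) -{2}(gtr0_norm ps) -normrM.
by rewrite mulrBl divfK // gt_eqF.
Qed.

(** L'Hopital's rule at infinity: (e/2) psi plus or minus (phi - l psi) is nondecreasing from some S
    on, and the values at S are absorbed as psi tends to infinity. *)
Lemma asym_primitive phi psi dphi dpsi l :
  (\forall s \near +oo, is_derive (s : R) 1 phi (dphi s)) ->
  (\forall s \near +oo, is_derive (s : R) 1 psi (dpsi s)) ->
  (forall M, \forall s \near +oo, M <= psi s) ->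
  asym dphi dpsi l -> asym phi psi l.
Proof.
move=> D1 D2 psioo A e e0; have e2 : 0 < e / 2 by rewrite divr_gt0.
have /near_pinftyP[S SP] : \forall s \near +oo, [/\ is_derive (s : R) 1 phi (dphi s),
    is_derive s 1 psi (dpsi s) & `|dphi s - l * dpsi s| <= e / 2 * dpsi s].
  by have := A _ e2; move: D1 D2; apply: filterS3.
pose D s := phi s - l * psi s.
have key (c s : R) : `|c| = 1 -> S <= s ->
    0 <= (e / 2 * psi s + c * D s) - (e / 2 * psi S + c * D S).
  move=> c1 Ss; rewrite -[leLHS](mul0r (s - S)).
  apply: (@mvt_ge _ (fun s => e / 2 * psi s + c * D s)
     (fun s => e / 2 * dpsi s + c * (dphi s - l * dpsi s))) => // t /andP[St _].
    have [d1 d2 _] := SP _ St.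
    by apply: is_derive_eq; rewrite /GRing.scale.
  have [_ _ d3] := SP _ St.
  have := ler_norm (- (c * (dphi t - l * dpsi t))); rewrite normrN normrM c1 mul1r; lra.
have P1 := psioo ((`|D S| + e / 2 * `|psi S|) / (e / 2)).
have P2 : \forall s \near +oo, S <= s by apply/near_pinftyP; exists S.
move: P1 P2; apply: filterS2 => s; rewrite ler_pdivrMr // => ps Ss.
have := key 1 s (normr1 _) Ss; have := key (-1) s (normrN1 _) Ss.
have := ler_norm (D S); have := ler_norm (- D S); rewrite normrN.
have : - `|psi S| * (e / 2) <= psi S * (e / 2).
  by rewrite ler_pM2r // lerNl -normrN ler_norm.
move=> h1 h2 h3 h4 h5; rewrite -/(D s) ler_norml; apply/andP; split; lra.
Qed.

Lemma asym_pos phi psi l : 0 < l -> (\forall s \near +oo, 0 < psi s) ->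
  asym phi psi l -> \forall s \near +oo, 0 < phi s.
Proof.
move=> l0 ps0 A; have l2 : 0 < l / 2 by rewrite divr_gt0.
have := A _ l2; move: ps0; apply: filterS2 => s ps; rewrite ler_norml => /andP[+ _].
have := mulr_gt0 l0 ps; lra.
Qed.

(** The model psi has logarithmic derivative P / m, and phi inherits any p < P; [e] solves p (l + e)
    = P (l - e), which uses up the gap exactly. *)
Lemma asym_log_derive_ge m phi psi phi1 psi1 l P p : 0 < l -> 0 <= p -> p < P ->
  (\forall s \near +oo, 0 < psi s) -> (\forall s \near +oo, 0 < m s) ->
  (\forall s \near +oo, m s * psi1 s = P * psi s) ->
  asym phi psi l -> asym phi1 psi1 l ->
  \forall s \near +oo, p * phi s <= m s * phi1 s.
Proof.
move=> l0 p0 pP ps0 m0 mp A A1; have Pp : 0 < P + p by lra.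
pose e := l * (P - p) / (P + p).
have e0 : 0 < e by rewrite divr_gt0 // mulr_gt0 //; lra.
have eP : p * (l + e) = P * (l - e) by rewrite /e; field; rewrite gt_eqF.
near=> s.
have ms : 0 < m s by near: s.
have mps : m s * psi1 s = P * psi s by near: s.
have : `|phi s - l * psi s| <= e * psi s by near: s; exact: A.
have : `|phi1 s - l * psi1 s| <= e * psi1 s by near: s; exact: A1.
rewrite !ler_norml => /andP[h2 _] /andP[_ h1].
have h3 : p * phi s <= p * ((l + e) * psi s) by rewrite ler_wpM2l //; lra.
have h4 : m s * ((l - e) * psi1 s) <= m s * phi1 s by rewrite ler_pM2l //; lra.
have h5 : m s * ((l - e) * psi1 s) = p * (l + e) * psi s by rewrite mulrCA mps eP; ring.
lra.
Unshelve. all: by end_near.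
Qed.

(** The model only satisfies an inequality, which suits powers of the logarithm, where m psi1 / psi
    tends to 0. *)
Lemma asym_log_derive_le m phi psi phi1 psi1 l P p : 0 < l -> 0 <= P -> P < p ->
  (\forall s \near +oo, 0 < psi s) -> (\forall s \near +oo, 0 < m s) ->
  (\forall s \near +oo, m s * psi1 s <= P * psi s) ->
  asym phi psi l -> asym phi1 psi1 l ->
  \forall s \near +oo, m s * phi1 s <= p * phi s.
Proof.
move=> l0 P0 pP ps0 m0 mp A A1; have Pp : 0 < P + p by lra.
pose e := l * (p - P) / (P + p).
have e0 : 0 < e by rewrite divr_gt0 // mulr_gt0 //; lra.
have eP : p * (l - e) = P * (l + e) by rewrite /e; field; rewrite gt_eqF.
near=> s.
have ms : 0 < m s by near: s.
have mps : m s * psi1 s <= P * psi s by near: s.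
have : `|phi s - l * psi s| <= e * psi s by near: s; exact: A.
have : `|phi1 s - l * psi1 s| <= e * psi1 s by near: s; exact: A1.
rewrite !ler_norml => /andP[_ h2] /andP[h1 _].
have h3 : p * ((l - e) * psi s) <= p * phi s by rewrite ler_wpM2l //; lra.
have h4 : m s * phi1 s <= m s * ((l + e) * psi1 s) by rewrite ler_pM2l //; lra.
have h5 : (l + e) * (m s * psi1 s) <= (l + e) * (P * psi s) by rewrite ler_wpM2l //; lra.
have h6 : p * ((l - e) * psi s) = (l + e) * (P * psi s) by rewrite mulrA eP; ring.
rewrite mulrCA in h4; lra.
Unshelve. all: by end_near.
Qed.

Lemma near_powR_ge (q M : R) : 0 < q -> \forall s \near +oo, M <= s `^ q.
Proof.
move=> q0; apply/near_pinftyP; exists (`|M| `^ q^-1) => s Ms.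
apply: le_trans (ler_norm _) _.
rewrite -[leLHS]powRr1 // -(mulVf (lt0r_neq0 q0)) powRrM.
apply: ge0_ler_powR => //; first exact: ltW.
  by rewrite nnegrE powR_ge0.
by rewrite nnegrE; apply: le_trans Ms; exact: powR_ge0.
Qed.

Lemma near_gt0 : \forall s \near +oo, 0 < (s : R).
Proof. by apply/near_pinftyP; exists 1 => s; lra. Qed.

Lemma is_derive_powR_div (q : R) s : 0 < q -> 0 < s ->
  is_derive s 1 (fun t : R => t `^ q / q) (s `^ (q - 1)).
Proof.
move=> q0 s0; have D := is_derive1_powR q s0.
by apply: is_derive_eq; rewrite /GRing.scale /=; field; rewrite gt_eqF.
Qed.

Lemma near_powR_div_ge (q M : R) : 0 < q -> \forall s \near +oo, M <= s `^ q / q.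
Proof.
by move=> q0; have := near_powR_ge (M * q) q0; apply: filterS => s; rewrite ler_pdivlMr.
Qed.

(** For q > 1 both s^(q-1) and s^q tend to infinity, so neither constant of integration matters. *)
Lemma asym_powR g (q l : R) : class_C2 g -> 1 < q ->
  derive1n 2 g s / s `^ (q - 2) @[s --> +oo] --> l ->
  asym (derive1 g) (fun s => s `^ (q - 1) / (q - 1)) l /\
  asym g (fun s => s `^ q / (q * (q - 1))) l.
Proof.
move=> gC q1 lim; have q10 : 0 < q - 1 by lra.
have q0 : 0 < q by lra.
have A0 : asym (derive1n 2 g) (fun s => s `^ (q - 2)) l.
  by apply: cvg_asym lim; have := near_gt0; apply: filterS => s s0; exact: powR_gt0.
have A1 : asym (derive1 g) (fun s => s `^ (q - 1) / (q - 1)) l.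
  apply: asym_primitive A0.
  - by apply: filterE => s; exact: class_C2_derive1.
  - have := near_gt0; apply: filterS => s s0.
    rewrite (_ : q - 2 = q - 1 - 1); last by ring.
    exact: is_derive_powR_div.
  - by move=> M; exact: near_powR_div_ge.
split=> //; apply: asym_primitive A1.
- by apply: filterE => s; exact: class_C2_derive.
- have := near_gt0; apply: filterS => s s0.
  have D := is_derive_powR_div q0 s0.
  have -> : (fun t : R => t `^ q / (q * (q - 1))) = (fun t => t `^ q / q * (q - 1)^-1).
    by apply/funext => t; rewrite invfM mulrA.
  by apply: is_derive_eq; rewrite /GRing.scale /=; ring.
- move=> M; have := near_powR_div_ge (M * (q - 1)) q0; apply: filterS => s Ms.
  by rewrite invfM mulrA ler_pdivlMr.
Qed.

Lemma asym_expR g (c l : R) : class_C2 g -> 0 < c ->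
  derive1n 2 g s / expR (c * s) @[s --> +oo] --> l ->
  asym (derive1 g) (fun s => expR (c * s) / c) l /\
  asym g (fun s => expR (c * s) / c ^+ 2) l.
Proof.
move=> gC c0 lim.
have E (s : R) : is_derive s 1 (fun t => expR (c * t)) (c * expR (c * s)).
  have D1 : is_derive s 1 (fun t : R => c * t) c.
    by apply: is_derive_eq; rewrite /GRing.scale /=; ring.
  by rewrite mulrC; exact: (is_derive1_comp (is_derive_expR _) D1).
have Eoo (d M : R) : 0 < d -> \forall s \near +oo, M <= expR (c * s) / d.
  move=> d0; apply/near_pinftyP; exists (M * d / c) => s.
  rewrite ler_pdivrMr // ler_pdivlMr // mulrC => Ms.
  have := expR_ge1Dx (c * s); lra.
have A0 : asym (derive1n 2 g) (fun s => expR (c * s)) l.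
  by apply: cvg_asym lim; apply: filterE => s; exact: expR_gt0.
have A1 : asym (derive1 g) (fun s => expR (c * s) / c) l.
  apply: asym_primitive A0.
  - by apply: filterE => s; exact: class_C2_derive1.
  - apply: filterE => s; have D := E s.
    by apply: is_derive_eq; rewrite /GRing.scale /=; field; rewrite gt_eqF.
  - by move=> M; exact: Eoo.
split=> //; apply: asym_primitive A1.
- by apply: filterE => s; exact: class_C2_derive.
- apply: filterE => s; have D := E s.
  by apply: is_derive_eq; rewrite /GRing.scale /=; field; rewrite gt_eqF.
- by move=> M; apply: Eoo; exact: exprn_gt0.
Qed.

(** * Logarithmic derivatives of f and a in each regime *)

Lemma F_pol_growth f (p finf q : R) : class_C2 f -> 1 < p -> 0 < finf -> 0 <= q -> q < p ->
  F_pol f p finf ->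
  \forall s \near +oo, 0 < f s /\ q * f s <= s * derive1 f s.
Proof.
move=> fC p1 finf0 q0 qp; have p0 : 0 < p by lra.
move=> /(asym_powR fC p1)[A1 A].
have l0 : 0 < p * (p - 1) * finf by rewrite !mulr_gt0 //; lra.
have ps0 : \forall s \near +oo, 0 < s `^ p / (p * (p - 1)).
  have := near_gt0; apply: filterS => s s0.
  by rewrite divr_gt0 ?powR_gt0 // mulr_gt0 //; lra.
apply: filterI; first exact: asym_pos A.
apply: (@asym_log_derive_ge id _ _ _ _ _ p q l0 q0 qp ps0 near_gt0 _ A A1).
have := near_gt0; apply: filterS => s s0.
rewrite mulrA (mulr_powRB1 (ltW s0) p0); field; apply/andP; split; lra.
Qed.

Lemma F_exp_growth f (beta finf q : R) : class_C2 f -> 0 < beta -> 0 < finf ->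
  0 <= q -> q < 2 * beta -> F_exp f beta finf ->
  \forall s \near +oo, 0 < f s /\ q * f s <= derive1 f s.
Proof.
move=> fC b0 finf0 q0 qp F; have c0 : 0 < 2 * beta by rewrite mulr_gt0.
have [A1 A] := asym_expR fC c0 F.
have l0 : 0 < 4 * beta ^+ 2 * finf by rewrite !mulr_gt0 // exprn_gt0.
have ps0 : \forall s \near +oo, 0 < expR (2 * beta * s) / (2 * beta) ^+ 2.
  by apply: filterE => s; rewrite divr_gt0 ?expR_gt0 // exprn_gt0.
apply: filterI; first exact: asym_pos A.
have H : \forall s \near +oo, q * f s <= 1 * derive1 f s.
  apply: (@asym_log_derive_ge (fun=> 1) _ _ _ _ _ (2 * beta) q l0 q0 qp ps0 _ _ A A1).
    by apply: filterE => s.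
  by apply: filterE => s; field; lra.
by move: H; apply: filterS => s; rewrite mul1r.
Qed.

(** f' / f stays above beta, so s f' / f exceeds every constant. *)
Lemma F_exp_growth_mul f (beta finf q : R) : class_C2 f -> 0 < beta -> 0 < finf ->
  0 <= q -> F_exp f beta finf ->
  \forall s \near +oo, 0 < f s /\ q * f s <= s * derive1 f s.
Proof.
move=> fC b0 finf0 q0 F.
have H := F_exp_growth fC b0 finf0 (ltW b0) (_ : beta < 2 * beta) F.
have Q : \forall s \near +oo, q / beta <= s by apply/near_pinftyP; exists (q / beta).
have {}H : \forall s \near +oo, 0 < f s /\ beta * f s <= derive1 f s by apply: H; lra.
move: near_gt0 Q H; apply: filterS3 => s s0; rewrite ler_pdivrMr // => qs [f0 bf].
split => //; have : s * (beta * f s) <= s * derive1 f s by rewrite ler_pM2l.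
have : q * f s <= s * beta * f s by rewrite ler_pM2r.
lra.
Qed.

Lemma A_pol_growth a (k ainf q : R) : class_C2 a -> 0 < k -> 0 < ainf -> k < q ->
  A_pol a k ainf -> \forall s \near +oo, s * derive1 a s <= q * a s.
Proof.
(* For k <= 1 the power s^(k-1) does not tend to infinity, so integration starts from the limit of
   a'; for k > 1 the limit of a'' is integrated twice. *)
move=> aC k0 ainf0 kq [lim1 lim2]; have [k1|k1] := leP k 1.
  have l0 : 0 < k * ainf by rewrite mulr_gt0.
  have A1 : asym (derive1 a) (fun s => s `^ (k - 1)) (k * ainf).
    apply: cvg_asym (lim1 k1).
    by have := near_gt0; apply: filterS => s s0; exact: powR_gt0.
  have A : asym a (fun s => s `^ k / k) (k * ainf).
    apply: asym_primitive A1.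
    - by apply: filterE => s; exact: class_C2_derive.
    - by have := near_gt0; apply: filterS => s s0; exact: is_derive_powR_div.
    - by move=> M; exact: near_powR_div_ge.
  apply: (@asym_log_derive_le id _ _ _ _ _ k q l0 (ltW k0) kq _ near_gt0 _ A A1).
    by have := near_gt0; apply: filterS => s s0; rewrite divr_gt0 ?powR_gt0.
  have := near_gt0; apply: filterS => s s0.
  by rewrite (mulr_powRB1 (ltW s0) k0) mulrC divfK // gt_eqF.
have [A1 A] := asym_powR aC k1 lim2.
have l0 : 0 < k * (k - 1) * ainf by rewrite !mulr_gt0 //; lra.
apply: (@asym_log_derive_le id _ _ _ _ _ k q l0 (ltW k0) kq _ near_gt0 _ A A1).
  have := near_gt0; apply: filterS => s s0.
  by rewrite divr_gt0 ?powR_gt0 // mulr_gt0 //; lra.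
have := near_gt0; apply: filterS => s s0.
rewrite mulrA (mulr_powRB1 (ltW s0) k0) le_eqVlt; apply/orP; left; apply/eqP.
field; apply/andP; split; lra.
Qed.

Lemma A_exp_growth a (gamma ainf q : R) : class_C2 a -> 0 < gamma -> 0 < ainf ->
  2 * gamma < q -> A_exp a gamma ainf ->
  \forall s \near +oo, derive1 a s <= q * a s.
Proof.
move=> aC g0 ainf0 gq A2; have c0 : 0 < 2 * gamma by rewrite mulr_gt0.
have [A1 A] := asym_expR aC c0 A2.
have l0 : 0 < 4 * gamma ^+ 2 * ainf by rewrite !mulr_gt0 // exprn_gt0.
have H : \forall s \near +oo, 1 * derive1 a s <= q * a s.
  apply: (@asym_log_derive_le (fun=> 1) _ _ _ _ _ (2 * gamma) q l0 (ltW c0) gq _ _ _ A A1).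
  - by apply: filterE => s; rewrite divr_gt0 ?expR_gt0 // exprn_gt0.
  - by apply: filterE => s.
  - apply: filterE => s; rewrite le_eqVlt; apply/orP; left; apply/eqP.
    by field; lra.
by move: H; apply: filterS => s; rewrite mul1r.
Qed.

(** s a' / a behaves like 2 gamma / ln s and falls below every q > 0. The model (ln s)^(c-1) / s has
    the primitive (ln s)^c / c, which diverges for every c > 0. *)
Lemma A_log_growth a (gamma ainf q : R) : class_C2 a -> 0 < gamma -> 0 < ainf ->
  0 < q -> A_log a gamma ainf -> \forall s \near +oo, s * derive1 a s <= q * a s.
Proof.
move=> aC g0 ainf0 q0 [lim _]; pose c := 2 * gamma.
have c0 : 0 < c by rewrite mulr_gt0.
have l0 : 0 < c * ainf by rewrite mulr_gt0.
have ln_ge (M : R) : \forall s \near +oo, M <= ln (s : R).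
  apply/near_pinftyP; exists (expR M) => s Ms.
  by rewrite -[leLHS]expRK ler_ln ?posrE ?expR_gt0 // (lt_le_trans _ Ms) ?expR_gt0.
have ln_gt0 : \forall s \near +oo, 0 < s /\ 0 < ln (s : R).
  by apply: filterI; [exact: near_gt0|have := ln_ge 1; apply: filterS => s; lra].
have A1 : asym (derive1 a) (fun s => ln s `^ (c - 1) / s) (c * ainf).
  apply: cvg_asym.
    by move: ln_gt0; apply: filterS => s [s0 l1]; rewrite divr_gt0 // powR_gt0.
  by under eq_cvg do rewrite invf_div mulrA.
have A : asym a (fun s => ln s `^ c / c) (c * ainf).
  apply: asym_primitive A1.
  - by apply: filterE => s; exact: class_C2_derive.
  - move: ln_gt0; apply: filterS => s [s0 l1].
    exact: (is_derive1_comp (is_derive_powR_div c0 l1) (is_derive1_ln s0)).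
  - move=> M; have /near_pinftyP[S SP] := near_powR_div_ge M c0.
    by have := ln_ge S; apply: filterS => s; exact: SP.
have q20 : 0 < q / 2 by rewrite divr_gt0.
have q2 : q / 2 < q by lra.
apply: (@asym_log_derive_le id _ _ _ _ _ (q / 2) q l0 (ltW q20) q2 _ near_gt0 _ A A1).
  by move: ln_gt0; apply: filterS => s [s0 l1]; rewrite divr_gt0 // powR_gt0.
have := ln_ge (c / (q / 2)); move: ln_gt0; apply: filterS2 => s [s0 l1].
rewrite ler_pdivrMr // => cq; rewrite mulrCA divff ?gt_eqF // mulr1.
rewrite -(mulr_powRB1 (ltW l1) c0); set X := ln s `^ _.
have -> : q / 2 * (ln s * X / c) = q / 2 * ln s / c * X by ring.
apply: ler_peMl; first exact: powR_ge0.
by rewrite ler_pdivlMr // mul1r mulrC.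
Qed.

End Asymptotics.

Theorem theorem1p4 (R : realType) (N : nat) (hN : (1 <= N)%N)
    (a f : R -> R) (nu : R)
    (a_C2 : class_C2 a) (f_C2 : class_C2 f)
    (a_pos : forall s, 0 < a s) (nu_pos : 0 < nu) (a_ge : forall s, nu <= a s) :
  [/\ (exists k beta ainf finf : R,
         [/\ 0 < k, 0 < beta, 0 < ainf & 0 < finf] /\
         (A_pol a k ainf /\ F_exp f beta finf)) ->
      forall u : 'rV[R]_N -> R, solves_P a f u -> radial_increasing u,
      (exists k p ainf finf : R,
         [/\ 0 < k, 1 < p, 0 < ainf & 0 < finf] /\
         [/\ A_pol a k ainf, F_pol f p finf & k + 1 < p]) ->
      forall u : 'rV[R]_N -> R, solves_P a f u -> radial_increasing u,
      (exists gamma beta ainf finf : R,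
         [/\ 0 < gamma, 0 < beta, 0 < ainf & 0 < finf] /\
         [/\ A_exp a gamma ainf, F_exp f beta finf & gamma < beta]) ->
      forall u : 'rV[R]_N -> R, solves_P a f u -> radial_increasing u,
      (exists gamma beta ainf finf : R,
         [/\ 0 < gamma, 0 < beta, 0 < ainf & 0 < finf] /\
         (A_log a gamma ainf /\ F_exp f beta finf)) ->
      forall u : 'rV[R]_N -> R, solves_P a f u -> radial_increasing u &
      (exists gamma p ainf finf : R,
         [/\ 0 < gamma, 1 < p, 0 < ainf & 0 < finf] /\
         (A_log a gamma ainf /\ F_pol f p finf)) ->
      forall u : 'rV[R]_N -> R, solves_P a f u -> radial_increasing u].
Proof.
have mul_case (q p : R) (u : 'rV[R]_N -> R) : 0 <= q -> q + 1 < p ->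
    (\forall s \near +oo, s * derive1 a s <= q * a s) ->
    (\forall s \near +oo, 0 < f s /\ p * f s <= s * derive1 f s) ->
    solves_P a f u -> radial_increasing u.
  move=> q0 qp Ha Hf.
  have /near_pinftyP[S SP] : \forall s \near +oo, [/\ 0 < (s : R),
      s * derive1 a s <= q * a s & 0 < f s /\ p * f s <= s * derive1 f s].
    by move: (@near_gt0 R) Ha Hf; apply: filterS3.
  apply: (@growth_radial _ _ hN a f id (fun=> 1) nu q 1 p S u) => //.
    by move=> s /SP[s0 _ _]; split => //; exact: is_derive_id.
  by move=> s /SP[_ ? []].
have exp_case (q p : R) (u : 'rV[R]_N -> R) : 0 <= q -> q < p ->
    (\forall s \near +oo, derive1 a s <= q * a s) ->
    (\forall s \near +oo, 0 < f s /\ p * f s <= derive1 f s) ->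
    solves_P a f u -> radial_increasing u.
  move=> q0 qp Ha Hf.
  have /near_pinftyP[S SP] : \forall s \near +oo,
      derive1 a s <= q * a s /\ (0 < f s /\ p * f s <= derive1 f s).
    by move: Ha Hf; apply: filterS2.
  apply: (@growth_radial _ _ hN a f (fun=> 1) (fun=> 0) nu q 0 p S u) => //.
  - by rewrite addr0.
  - by move=> s _; split => //; exact: is_derive_cst.
  by move=> s /SP[? []]; rewrite !mul1r.
split.
- move=> [k [beta [ainf [finf [[k0 b0 ai fi] [Ap Fe]]]]]] u.
  (* For exponential f every lower constant is available, so any upper constant above k will do. *)
  apply: (mul_case (k + 1) (k + 3)); [lra|lra| |].
    by apply: A_pol_growth Ap => //; lra.
  by apply: F_exp_growth_mul Fe => //; lra.
- move=> [k [p [ainf [finf [[k0 p1 ai fi] [Ap Fp kp]]]]]] u.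
  (* The gap p - k - 1 is split in three: one third of slack for a, one for f, and one for the
     strict inequality between them. *)
  apply: (mul_case (k + (p - k - 1) / 3) (p - (p - k - 1) / 3)); [lra|lra| |].
    by apply: A_pol_growth Ap => //; lra.
  by apply: F_pol_growth Fp => //; lra.
- move=> [g [beta [ainf [finf [[g0 b0 ai fi] [Ae Fe gb]]]]]] u.
  (* Each exponent gives up (beta - g) / 2 of the gap 2 (beta - g), and beta - g remains. *)
  apply: (exp_case (2 * g + (beta - g) / 2) (2 * beta - (beta - g) / 2)); [lra|lra| |].
    by apply: A_exp_growth Ae => //; lra.
  by apply: F_exp_growth Fe => //; lra.
- move=> [g [beta [ainf [finf [[g0 b0 ai fi] [Al Fe]]]]]] u.
  (* Every positive constant is allowed for a and every constant for f; 1 and 3 leave the required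
     gap. *)
  apply: (mul_case 1 3); [lra|lra| |].
    by apply: A_log_growth Al => //; lra.
  by apply: F_exp_growth_mul Fe => //; lra.
move=> [g [p [ainf [finf [[g0 p1 ai fi] [Al Fp]]]]]] u.
(* The same split in three with k replaced by 0, the growth exponent of a power of the logarithm. *)
apply: (mul_case ((p - 1) / 3) (p - (p - 1) / 3)); [lra|lra| |].
  by apply: A_log_growth Al => //; lra.
by apply: F_pol_growth Fp => //; lra.
Qed.
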